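(* Let $A$, $Q$, $q$, $\sigma$ and $H_{A,Q}$ be as in the context. The group $H_{A,Q}$ is isomorphic to a lamplighter group $L\wr G$ with $L$ finitely generated and $G\simeq\mathbb Z^k$ if and only if the group $V:=\langle \sigma^p\,\mathfrak S(Q)\,\sigma^{-p},\ p\in\{0,\dots,q-1\}\rangle$ is abelian. In this case, $A\simeq\mathbb Z^k$ and $Q\simeq L$ is finite and abelian.
   Context: An interval exchange transformation (iet) is a bijection $f:[0,1)\to[0,1)$ for which there is a finite partition of $[0,1)$ into half-open intervals $[a,b)$ on each of which $f$ is a translation. The iets form a group $\mathrm{IET}$ under composition. For $a\in\mathbb R/\mathbb Z$, $R_a\in\mathrm{IET}$ is the rotation $x\mapsto x+a \bmod 1$. For an integer $q\ge 1$ let $I_i=[\frac{i-1}{q},\frac{i}{q})$, $1\le i\le q$. For $\tau$ in the symmetric group $\mathcal S_q$ on $\{1,\dots,q\}$, $E_\tau$ is the iet that is a translation on each $I_i$ with $E_\tau(I_i)=I_{\tau(i)}$. Put $\mathcal G_{1/q}=\{E_\tau:\tau\in\mathcal S_q\}$; the map $\mathfrak S:\mathcal G_{1/q}\to\mathcal S_q$, $E_\tau\mapsto\tau$, is an isomorphism. $\sigma=\sigma_q$ is the $q$-cycle $(1,2,\dots,q)\in\mathcal S_q$. Setup: $s,m,q\geq 1$ are integers; $\alpha_1,\dots,\alpha_s\in(\mathbb R/\mathbb Z)\setminus(\mathbb Q/\mathbb Z)$ are $\mathbb Q$-independent (i.e. $\sum n_i\alpha_i=0$ in $\mathbb R/\mathbb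 Z$ with $n_i\in\mathbb Z$ forces all $n_i=0$; equivalently, for real representatives, $1,\alpha_1,\dots,\alpha_s$ are linearly independent over $\mathbb Q$); $A=\langle\alpha_1,\dots,\alpha_s\rangle\simeq\mathbb Z^s$ is the subgroup of $\mathbb R/\mathbb Z$ they generate; $g_1,\dots,g_m\in\mathcal G_{1/q}$ and $Q=\langle g_1,\dots,g_m\rangle\le\mathcal G_{1/q}$; and $H_{A,Q}=\langle R_{\alpha_1},\dots,R_{\alpha_s},g_1,\dots,g_m\rangle\le\mathrm{IET}$. $L\wr G=\bigl(\bigoplus_{g\in G}L\bigr)\rtimes G$ is the (restricted) wreath product, $G$ permuting the copies of $L$ by translation of the index. In a lamplighter group $L\wr G$ it is understood that $L$ and $G$ are non trivial finitely generated groups and that $G$ is not a torsion group (so $k\ge1$).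
   Formalization: The condition ''V is abelian'' is replaced by ''V is abelian, Q is nontrivial and no nontrivial element of S(Q) commutes with σ'': as printed it fails for s=1, q≥2, Q=⟨E_σ⟩, where V is abelian but H=⟨R_α,R_{1/q}⟩ ≅ Z×Z/q is abelian, hence not a lamplighter group. *)

(* Defs.v *)
From HB Require Import structures.
From mathcomp Require Import all_boot all_order all_algebra all_fingroup.
From mathcomp Require Import boolp classical_sets functions cardinality.
From mathcomp Require Import set_interval reals lra.

Set Implicit Arguments.
Unset Strict Implicit.
Unset Printing Implicit Defensive.

Import Order.TTheory GRing.Theory Num.Theory.

Local Open Scope classical_set_scope.
Local Open Scope ring_scope.

(* [circle R] is [0, 1); with addition modulo 1 it is also R/Z, every class
   being identified with its representative in [0, 1). *)
Record circle (R : realType) :=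
  Circle { circle_val :> R; circle_valP : 0 <= circle_val < 1 }.

HB.instance Definition _ (R : realType) := [isSub for @circle_val R].
HB.instance Definition _ (R : realType) := [Choice of circle R by <:].

Lemma mod1_subproof (R : realType) (x : R) :
  0 <= x - (Num.floor x)%:~R < 1.
Proof.
by have := floor_itv x; rewrite intrD => /andP[? ?]; apply/andP; split; lra.
Qed.

Definition mod1 (R : realType) (x : R) : circle R := Circle (mod1_subproof x).

Lemma mod1_id (R : realType) (y : R) : 0 <= y < 1 -> val (mod1 y) = y.
Proof.
by move=> hy; rewrite /= (_ : Num.floor y = 0) ?subr0//; apply: floor_def.
Qed.

Lemma mod1_val (R : realType) (x : circle R) : mod1 (val x) = x.
Proof. by apply: val_inj; rewrite mod1_id//; exact: circle_valP. Qed.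

Lemma mod1_eq (R : realType) (x y : R) :
  y - x \is a Num.int -> mod1 x = mod1 y.
Proof.
move=> xy; apply: val_inj => /=.
have -> : y = x + (y - x) by lra.
by rewrite floorDrz// intrD [(Num.floor (y - x))%:~R]floorK//; lra.
Qed.

Lemma mod1_int (R : realType) (x : R) : x - val (mod1 x) \is a Num.int.
Proof. by rewrite /= opprB addrC subrK intr_int. Qed.

Definition circle_add (R : realType) (x y : circle R) : circle R :=
  mod1 (val x + val y).
Definition circle_opp (R : realType) (x : circle R) : circle R :=
  mod1 (- val x).

Lemma circle_addA (R : realType) : associative (@circle_add R).
Proof.
move=> x y z; apply: mod1_eq.
have := rpredB (mod1_int (val y + val z)) (mod1_int (val x + val y)).
rewrite /circle_add; set u := mod1 (_ + _); set v := mod1 (_ + _) => h.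
by rewrite (_ : _ - _ = val y + val z - val u - (val x + val y - val v)) //; lra.
Qed.

Lemma circle_addC (R : realType) : commutative (@circle_add R).
Proof. by move=> x y; rewrite /circle_add addrC. Qed.

Lemma circle_add0 (R : realType) : left_id (mod1 0) (@circle_add R).
Proof.
by move=> x; rewrite /circle_add /= floor0 subr0 add0r; exact: mod1_val.
Qed.

Lemma circle_addN (R : realType) :
  left_inverse (mod1 0) (@circle_opp R) (@circle_add R).
Proof.
move=> x; apply: mod1_eq.
have := mod1_int (- val x); rewrite /circle_opp; set u := mod1 _ => h.
by rewrite (_ : _ - _ = - val x - val u) //; lra.
Qed.

HB.instance Definition _ (R : realType) :=
  GRing.isZmodule.Build (circle R) (@circle_addA R) (@circle_addC R)
    (@circle_add0 R) (@circle_addN R).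

Definition piecewise_translation (R : realType) (f : circle R -> circle R) :=
  exists (I : finType) (a b : I -> R),
    partition [set: I] (fun i => `[a i, b i[%classic) `[0, 1[%classic /\
    forall i, exists t : R, forall x : circle R,
      a i <= val x < b i -> val (f x) = val x + t.

Definition is_iet (R : realType) (f : circle R -> circle R) :=
  bijective f /\ piecewise_translation f.

Record IET (R : realType) :=
  MkIET { iet_fun :> circle R -> circle R; ietP : is_iet iet_fun }.

Lemma iet_eq (R : realType) (f g : IET R) : f =1 g -> f = g.
Proof.
case: f g => [f fP] [g gP] /= /funext fg; move: fP; rewrite fg => fP.
by congr MkIET; exact: Prop_irrelevance.
Qed.

Lemma piecewise_translationP (R : realType) (f : circle R -> circle R)
    (I : finType) (a b t : I -> R) :
  (forall x : circle R, exists i, a i <= val x < b i) ->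
  (forall (x : circle R) i j,
     a i <= val x < b i -> a j <= val x < b j -> i = j) ->
  (forall i (x : circle R), a i <= val x < b i -> val (f x) = val x + t i) ->
  piecewise_translation f.
Proof.
move=> cov disj tr.
pose a' i := Num.max (a i) 0; pose b' i := Num.min (b i) 1.
have ab (x : circle R) i : (a' i <= val x < b' i) = (a i <= val x < b i).
  by rewrite /a' /b' ge_max lt_min; case/andP: (valP x) => -> ->; rewrite !andbT.
pose J := {i : I | a' i < b' i}.
exists J, (fun j => a' (val j)), (fun j => b' (val j)); split; last first.
  by move=> j; exists (t (val j)) => x; rewrite ab => /tr.
split.
- apply/seteqP; split=> [x [j _]|x] /=; rewrite !in_itv /=.
    move=> /andP[h1 h2]; apply/andP; split.
      by apply: le_trans h1; rewrite /a' le_max lexx orbT.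
    by apply: lt_le_trans h2 _; rewrite /b' ge_min lexx orbT.
  move=> hx; have [i] := cov (Circle hx); rewrite -ab /= => hi.
  have ji : a' i < b' i by case/andP: hi; exact: le_lt_trans.
  by exists (Sub i ji) => //=; rewrite in_itv.
- move=> i j _ _ [x [/=]]; rewrite !in_itv /= => hi hj.
  have hx : 0 <= x < 1.
    case/andP: hi => h1 h2; apply/andP; split.
      by apply: le_trans h1; rewrite /a' le_max lexx orbT.
    by apply: lt_le_trans h2 _; rewrite /b' ge_min lexx orbT.
  by apply/val_inj/(disj (Circle hx)); rewrite -ab.
- move=> i _; exists (a' (val i)) => /=; rewrite in_itv /= lexx.
  exact: (valP i).
Qed.

Lemma piecewise_translationE (R : realType) (f : circle R -> circle R) :
  piecewise_translation f ->
  exists (I : finType) (a b t : I -> R), [/\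
    forall i r, a i <= r < b i -> 0 <= r < 1,
    forall x : circle R, exists i, a i <= val x < b i,
    forall (x : circle R) i j,
     a i <= val x < b i -> a j <= val x < b j -> i = j &
    forall i (x : circle R), a i <= val x < b i -> val (f x) = val x + t i].
Proof.
case=> I [a [b [[cov disj _] /choice[t tr]]]]; exists I, a, b, t; split=> //.
- move=> i r hr; have : cover [set: I] (fun i => `[a i, b i[%classic) r.
    by exists i => //=; rewrite in_itv.
  by rewrite cov /= in_itv.
- move=> x; have : `[0, 1[%classic (val x) by rewrite /= in_itv; exact: (valP x).
  by rewrite -cov => -[i _] /=; rewrite in_itv; exists i.
- by move=> x i j hi hj; apply: disj => //; exists (val x); rewrite /= !in_itv.
Qed.

Lemma id_is_iet (R : realType) : is_iet (@id (circle R)).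
Proof.
split; first by exists id.
apply: (@piecewise_translationP _ _ unit (fun=> 0) (fun=> 1) (fun=> 0)).
- by move=> x; exists tt; exact: (valP x).
- by move=> x [] [].
- by move=> _ x _; rewrite addr0.
Qed.

Lemma comp_is_iet (R : realType) (f g : IET R) : is_iet (f \o g).
Proof.
case: (ietP f) (ietP g) => bf pf [bg pg]; split; first exact: bij_comp.
have [I [a [b [t [_ c1 d1 t1]]]]] := piecewise_translationE pg.
have [J [c [d [u [_ c2 d2 t2]]]]] := piecewise_translationE pf.
pose lo (k : I * J) := Num.max (a k.1) (c k.2 - t k.1).
pose hi (k : I * J) := Num.min (b k.1) (d k.2 - t k.1).
have key (x : circle R) k : lo k <= val x < hi k ->
    (a k.1 <= val x < b k.1) /\ (c k.2 <= val (g x) < d k.2).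
  rewrite ge_max lt_min => /andP[/andP[h1 h2] /andP[h3 h4]].
  have hk : a k.1 <= val x < b k.1 by rewrite h1.
  by split=> //; rewrite (t1 _ _ hk); apply/andP; split; lra.
apply: (@piecewise_translationP _ _ _ lo hi (fun k => t k.1 + u k.2)).
- move=> x; have [i hi1] := c1 x; have [j] := c2 (g x).
  rewrite (t1 _ _ hi1) => /andP[h1 h2]; exists (i, j).
  by rewrite ge_max lt_min lerBlDr ltrBrDr h1 h2 !andbT.
- move=> x [i j] [i' j'] /key[/= h1 h2] /key[/= h3 h4].
  by rewrite (d1 _ _ _ h1 h3) (d2 _ _ _ h2 h4).
- by move=> k x /key[h1 h2] /=; rewrite (t2 _ _ h2) (t1 _ _ h1) addrA.
Qed.

Lemma inv_is_iet (R : realType) (f : IET R) :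
  exists g : IET R, cancel f g /\ cancel g f.
Proof.
case: (ietP f) => -[g fK gK] pf.
have [I [a [b [t [r1 c1 d1 t1]]]]] := piecewise_translationE pf.
suff gP : is_iet g by exists (MkIET gP).
split; first by exists f.
have key (y : circle R) i : a i + t i <= val y < b i + t i ->
    a i <= val (g y) < b i /\ val (g y) = val y + - t i.
  move=> /andP[h1 h2].
  have h : a i <= val y - t i < b i by apply/andP; split; lra.
  suff e : g y = Circle (r1 _ _ h) by rewrite e.
  by apply: (can_inj fK); rewrite gK; apply: val_inj; rewrite (t1 i)//= subrK.
apply: (@piecewise_translationP _ _ _ (fun i => a i + t i)
  (fun i => b i + t i) (fun i => - t i)).
- move=> y; have [i hi] := c1 (g y); exists i.
  by rewrite -(gK y) (t1 _ _ hi); apply/andP; case/andP: hi; split; lra.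
- by move=> y i j /key[h1 _] /key[h2 _]; exact: d1 h1 h2.
- by move=> i y /key[].
Qed.

HB.instance Definition _ (R : realType) := gen_eqMixin (IET R).
HB.instance Definition _ (R : realType) := gen_choiceMixin (IET R).

Definition iet_one (R : realType) : IET R := MkIET (@id_is_iet R).
Definition iet_mul (R : realType) (f g : IET R) : IET R :=
  MkIET (comp_is_iet f g).
Definition iet_inv (R : realType) (f : IET R) : IET R :=
  sval (cid (inv_is_iet f)).

Lemma iet_mulA (R : realType) : associative (@iet_mul R).
Proof. by move=> f g h; apply: iet_eq. Qed.

Lemma iet_mul1 (R : realType) : left_id (@iet_one R) (@iet_mul R).
Proof. by move=> f; apply: iet_eq. Qed.

Lemma iet_mulr1 (R : realType) : right_id (@iet_one R) (@iet_mul R).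
Proof. by move=> f; apply: iet_eq. Qed.

Lemma iet_mulV (R : realType) :
  left_inverse (@iet_one R) (@iet_inv R) (@iet_mul R).
Proof.
by move=> f; apply: iet_eq => x; rewrite /iet_inv /=; case: cid => g [] /= ->.
Qed.

Lemma iet_mulrV (R : realType) :
  right_inverse (@iet_one R) (@iet_inv R) (@iet_mul R).
Proof.
by move=> f; apply: iet_eq => x; rewrite /iet_inv /=; case: cid => g [_] /= ->.
Qed.

(* [f * g] is the composite [f \o g]. *)
HB.instance Definition _ (R : realType) :=
  isGroup.Build (IET R) (@iet_mulA R) (@iet_mul1 R) (@iet_mulr1 R)
    (@iet_mulV R) (@iet_mulrV R).

Lemma rotation_is_iet (R : realType) (a : circle R) :
  is_iet (fun x : circle R => x + a).
Proof.
split; first by exists (fun x => x - a) => x; rewrite ?addrK ?subrK.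
have /andP[a0 a1] : 0 <= val a < 1 := circle_valP a.
apply: (@piecewise_translationP _ _ bool (fun i => if i then 0 else 1 - val a)
  (fun i => if i then 1 - val a else 1)
  (fun i => if i then val a else val a - 1)).
- move=> x; have /andP[x0 x1] : 0 <= val x < 1 := circle_valP x.
  by have [h|h] := ltP (val x) (1 - val a); [exists true|exists false];
    rewrite ?h ?x0 ?x1.
- by move=> x [] [] // /andP[h1 h2] /andP[h3 h4]; lra.
- move=> i x hx; have /andP[x0 x1] : 0 <= val x < 1 := circle_valP x.
  have -> : x + a = mod1 (val x + val a) by [].
  set u := val x in x0 x1 hx *; set v := val a in a0 a1 hx *.
  case: i hx => /andP[h1 h2]; rewrite /= in h1 h2.
    by rewrite mod1_id//; apply/andP; split; lra.
  have -> : mod1 (u + v) = mod1 (u + (v - 1)).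
    by apply: mod1_eq; rewrite (_ : _ - _ = -1) ?rpredN ?rpred1//; lra.
  by rewrite mod1_id//; apply/andP; split; lra.
Qed.

Definition rotation (R : realType) (a : circle R) : IET R := MkIET (rotation_is_iet a).

(* Cells are numbered from 0: the [i]-th one is [i/q, (i+1)/q). *)
Definition cell (R : realType) (q : nat) (x : circle R) : option 'I_q :=
  insub (Num.truncn (q%:R * val x)).

(* The default branch is never reached when [0 < q], and the argument of [mod1]
   is then already in [0, 1), so that the [i]-th cell is translated by
   [(tau i - i) / q]. *)
Definition block_fun (R : realType) (q : nat) (tau : 'S_q) (x : circle R) :
    circle R :=
  if cell q x is Some i then
    mod1 (val x + ((tau i)%:R - i%:R) / q%:R)
  else x.

Lemma cellP (R : realType) (q : nat) (x : circle R) (i : 'I_q) :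
  (cell q x == Some i) = (i%:R / q%:R <= val x < i.+1%:R / q%:R).
Proof.
have q0 : 0 < q%:R :> R by rewrite ltr0n (leq_ltn_trans _ (ltn_ord i)).
have /andP[x0 _] : 0 <= val x < 1 := circle_valP x.
rewrite ler_pdivrMr// ltr_pdivlMr// ![val x * _]mulrC -truncn_eq; last by rewrite mulr_ge0// ltW.
rewrite /cell; case: insubP => [j _ <-|/=].
  by [].
by move=> h; apply/esym/negbTE; apply: contra h => /eqP->.
Qed.

Lemma cell_ex (R : realType) (q : nat) (x : circle R) :
  (0 < q)%N -> exists i, cell q x = Some i.
Proof.
move=> q0; have /andP[x0 x1] : 0 <= val x < 1 := circle_valP x.
rewrite /cell; case: insubP => [i _ _|]; first by exists i.
rewrite -(ltr_nat R) => /negP[].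
have /andP[h _] := truncn_itv (mulr_ge0 (ler0n R q) x0).
by apply: le_lt_trans h _; rewrite gtr_pMr// ltr0n.
Qed.

Lemma block_funE (R : realType) (q : nat) (tau : 'S_q) (x : circle R) i :
  cell q x = Some i ->
  val (block_fun tau x) = val x + ((tau i)%:R - i%:R) / q%:R /\
  cell q (block_fun tau x) = Some (tau i).
Proof.
move=> ci; have q0 : (0 < q)%N by apply: leq_ltn_trans (ltn_ord i).
have qR : 0 < q%:R :> R by rewrite ltr0n.
have /andP[h1 h2] : i%:R / q%:R <= val x < i.+1%:R / q%:R by rewrite -cellP ci.
have e : val (block_fun tau x) = val x + ((tau i)%:R - i%:R) / q%:R.
  rewrite /block_fun ci mod1_id//.
  move: h1 h2; rewrite mulrBl -addn1 natrD mulrDl => h1 h2.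
  have p1 : 0 <= (tau i)%:R / q%:R :> R by rewrite divr_ge0.
  have p2 : (tau i)%:R / q%:R + 1 / q%:R <= 1 :> R.
    by rewrite -mulrDl ler_pdivrMr// mul1r natr1 ler_nat ltn_ord.
  by apply/andP; split; lra.
split=> //; apply/eqP; rewrite cellP e; move: h1 h2.
rewrite mulrBl -addn1 natrD mulrDl -[(tau i).+1]addn1 natrD mulrDl => h1 h2.
by apply/andP; split; lra.
Qed.

Lemma block_is_iet (R : realType) (q : nat) (tau : 'S_q) :
  is_iet (@block_fun R q tau).
Proof.
have bK (s : 'S_q) : cancel (@block_fun R q s) (block_fun s^-1%g).
  move=> x; case: (posnP q) => [q0|q0].
    have cN (y : circle R) : cell q y = None.
      by case: (cell q y) => // i; have := ltn_ord i; rewrite {2}q0.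
    by rewrite /block_fun !cN.
  have [i ci] := cell_ex x q0.
  have [e1 c1] := block_funE s ci; have [e2 c2] := block_funE s^-1%g c1.
  by apply: val_inj; rewrite e2 e1 permK -addrA -mulrDl; lra.
split; first by exists (block_fun tau^-1%g) => //; rewrite -{2}(invgK tau).
case: (posnP q) => [q0|q0].
  have -> : @block_fun R q tau = id; last exact: (id_is_iet R).2.
  apply/funext => x; rewrite /block_fun; case: (cell q x) => // i.
  by have := ltn_ord i; rewrite {2}q0.
apply: (@piecewise_translationP _ _ 'I_q (fun i => i%:R / q%:R)
  (fun i => i.+1%:R / q%:R) (fun i => ((tau i)%:R - i%:R) / q%:R)).
- by move=> x; have [i /eqP] := cell_ex x q0; rewrite cellP; exists i.
- by move=> x i j; rewrite -!cellP => /eqP-> /eqP[].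
- by move=> i x; rewrite -cellP => /eqP/(block_funE tau)[].
Qed.

Definition block_iet (R : realType) (q : nat) (tau : 'S_q) : IET R :=
  MkIET (@block_is_iet R q tau).

Definition block_group (R : realType) (q : nat) : set (IET R) :=
  range (@block_iet R q).

Definition gen_group (G : groupType) (S : set G) : set G :=
  smallest (fun B : set G =>
    B 1%g /\ forall x y, B x -> B y -> B (x * y^-1)%g) S.

Definition gen_zmod (M : zmodType) (S : set M) : set M :=
  smallest (fun B : set M => B 0 /\ forall x y, B x -> B y -> B (x - y)) S.

(* The operations are explicit because additive and multiplicative groups are
   compared. *)
Definition group_iso (T U : Type) (mT : T -> T -> T) (mU : U -> U -> U)
    (A : set T) (B : set U) : Prop :=
  exists2 f : T -> U, set_bij A B f &
    forall x y, A x -> A y -> f (mT x y) = mU (f x) (f y).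

Definition finitely_generated (G : groupType) : Prop :=
  exists2 F : set G, finite_set F & gen_group F = [set: G].

Definition nontrivial (G : groupType) : Prop := exists x : G, x <> 1%g.

Record wreath (L G : groupType) := Wreath {
  wr_base : G -> L;
  wr_top : G;
  wr_finite : finite_set [set x | wr_base x <> 1%g] }.

Lemma wreath_eq (L G : groupType) (u v : wreath L G) :
  wr_base u =1 wr_base v -> wr_top u = wr_top v -> u = v.
Proof.
case: u v => [f a fP] [g b gP] /= /funext fg ab; subst.
by congr Wreath; exact: Prop_irrelevance.
Qed.

HB.instance Definition _ (L G : groupType) := gen_eqMixin (wreath L G).
HB.instance Definition _ (L G : groupType) := gen_choiceMixin (wreath L G).

Lemma finite_translate (L G : groupType) (f : G -> L) (a : G) :
  finite_set [set x | f x <> 1%g] -> finite_set [set x | f (a * x)%g <> 1%g].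
Proof. by apply: finite_preimage => x y _ _ /mulgI. Qed.

Lemma wreath_one_subproof (L G : groupType) :
  finite_set [set x : G | (1 : L)%g <> 1%g].
Proof. by rewrite (_ : [set _ | _] = set0)//; apply/seteqP; split. Qed.

Lemma wreath_mul_subproof (L G : groupType) (u v : wreath L G) :
  finite_set [set x | (wr_base u x * wr_base v ((wr_top u)^-1 * x))%g <> 1%g].
Proof.
apply: (@sub_finite_set _ _ ([set x | wr_base u x <> 1%g] `|`
  [set x | wr_base v ((wr_top u)^-1 * x)%g <> 1%g])); last first.
  rewrite finite_setU; split; first exact: wr_finite.
  exact/finite_translate/wr_finite.
move=> x /= h; have [e|] := pselect (wr_base u x = 1%g); last by left.
by right => e'; apply: h; rewrite e e' mulg1.
Qed.

Lemma wreath_inv_subproof (L G : groupType) (u : wreath L G) :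
  finite_set [set x | ((wr_base u (wr_top u * x))^-1)%g <> 1%g].
Proof.
apply: sub_finite_set (finite_translate (wr_top u) (wr_finite u)).
by move=> x /= h e; apply: h; rewrite e invg1.
Qed.

(* The pair [(f, a)] is [f a] in the semidirect product, and [a] sends the
   family [f] to [x |-> f (a^-1 x)]. *)
Definition wreath_one (L G : groupType) : wreath L G :=
  @Wreath L G (fun=> 1%g) 1%g (@wreath_one_subproof L G).
Definition wreath_mul (L G : groupType) (u v : wreath L G) : wreath L G :=
  @Wreath L G _ (wr_top u * wr_top v)%g (wreath_mul_subproof u v).
Definition wreath_inv (L G : groupType) (u : wreath L G) : wreath L G :=
  @Wreath L G _ ((wr_top u)^-1)%g (wreath_inv_subproof u).

Lemma wreath_mulA (L G : groupType) : associative (@wreath_mul L G).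
Proof.
move=> u v w; apply: wreath_eq => [x|] /=; last exact: mulgA.
by rewrite invgM !mulgA.
Qed.

Lemma wreath_mul1 (L G : groupType) :
  left_id (@wreath_one L G) (@wreath_mul L G).
Proof.
by move=> u; apply: wreath_eq => [x|] /=; rewrite ?invg1 !mul1g.
Qed.

Lemma wreath_mulr1 (L G : groupType) :
  right_id (@wreath_one L G) (@wreath_mul L G).
Proof. by move=> u; apply: wreath_eq => [x|] /=; rewrite mulg1. Qed.

Lemma wreath_mulV (L G : groupType) :
  left_inverse (@wreath_one L G) (@wreath_inv L G) (@wreath_mul L G).
Proof.
by move=> u; apply: wreath_eq => [x|] /=; rewrite ?invgK mulVg.
Qed.

Lemma wreath_mulrV (L G : groupType) :
  right_inverse (@wreath_one L G) (@wreath_inv L G) (@wreath_mul L G).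
Proof.
by move=> u; apply: wreath_eq => [x|] /=; rewrite ?mulKVg mulgV.
Qed.

HB.instance Definition _ (L G : groupType) :=
  isGroup.Build (wreath L G) (@wreath_mulA L G) (@wreath_mul1 L G)
    (@wreath_mulr1 L G) (@wreath_mulV L G) (@wreath_mulrV L G).

(* For [G] isomorphic to Z^k, being non trivial, finitely generated and not a
   torsion group amounts to [0 < k]. *)
Definition lamplighter_iso (T : groupType) (H : set T) (k : nat)
    (L G : groupType) : Prop :=
  [/\ (0 < k)%N, nontrivial L, finitely_generated L,
      group_iso (fun x y : G => (x * y)%g) (fun x y : 'rV[int]_k => x + y)
        [set: G] [set: 'rV[int]_k] &
      group_iso (fun x y : T => (x * y)%g) (fun x y : wreath L G => (x * y)%g)
        H [set: wreath L G]].

Definition Q_independent (R : realType) (s : nat) (alpha : 'I_s -> circle R) :=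
  forall n : 'I_s -> int, \sum_i alpha i *~ n i = 0 -> forall i, n i = 0.

(* The image of [Q] under the inverse of the bijection [tau |-> block_iet tau]. *)
Definition symbols (R : realType) (q : nat) (Q : set (IET R)) : {set 'S_q} :=
  [set tau | `[< Q (block_iet R tau) >]]%SET.

Definition cycle_perm (q : nat) : 'S_q := perm (@ordS_inj q).

(* Products in ['S_q] are composed from left to right, so that [x :^ y], that is
   [y^-1 * x * y], conjugates the function [x] by the function [y] on the
   left. *)
Definition conj_group (R : realType) (q : nat) (Q : set (IET R)) : {set 'S_q} :=
  <<(\bigcup_(p < q) (symbols q Q :^ (cycle_perm q ^+ p)))%SET>>%g.

(* Main.v *)
Require Import Defs.
From HB Require Import structures.
From mathcomp Require Import all_boot all_order all_algebra all_fingroup.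
From mathcomp Require Import cyclic finmap.
From mathcomp Require Import boolp classical_sets functions cardinality.
From mathcomp Require Import set_interval reals lra.

(** Let [u] be the class of 1/q in the circle.  Rotations, and block permutations
    of the q cells, map every coset of <u> in the circle onto a coset of <u>; such
    a coset is called a fibre.  On the circle of fibres an element of H acts as
    a rotation by an element of A, its drift, because A meets <u> trivially.
    Drift is a homomorphism from H onto A; its kernel N is generated by the
    conjugates [conj_block a t] of the block permutations in Q by the rotations
    in A.  An element of N permutes the q points of each fibre, and is determined
    by these permutations of {0, ..., q-1}.  Those of [conj_block a t] are
    conjugates of [t] by powers of the q-cycle sigma: the exponent is the cell
    of the base point, translated by [- a].

    If V is abelian and no non trivial symbol of Q commutes with sigma, then
    these conjugates all commute, and [conj_block a t] with [t] non trivial has a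
    jump on the fibre of [a], and only there.  Hence a product of conjugates
    by distinct elements of A is trivial only if all factors are
    ([conj_block_free]), and H is the wreath product of Q and A
    ([wreath_recognition], [lamplighter_embedding]).

    Conversely let H be a wreath product of L and G, with G free abelian.
    Elements of N have finite order, as they permute fibres of q points; A and G
    are torsion free, and commutators have drift 0.  It follows that N is the
    base group ([base_drift]).  The heart of the matter is that L is abelian
    ([lamps_commute]).  If l and l' do not commute in one copy of L, then they
    do not commute on some interval of fibres; the conjugates of this interval by
    infinitely many elements of G are translates of it, so that two of them share
    a fibre on which the two copies of l induce the same permutation, whereas
    distinct copies of L commute.  So N is abelian, and as A is dense,
    every power of sigma occurs as a conjugator on a given fibre: V is abelian
    ([abelian_V]).  A symbol of Q that commutes with sigma gives a central
    element of H, and the centre of the wreath product is trivial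
    ([centralizer_trivial]).

    Finally A and G are both H modulo N.  By the first part H is also a wreath
    product of Q and A, with the same base group N, and for abelian lamps
    the lamp group is recovered from base and total group as the group of
    coinvariants of the base ([wreath_lamp_iso]). *)

Set Implicit Arguments.
Unset Strict Implicit.
Unset Printing Implicit Defensive.

Import Order.TTheory GRing.Theory Num.Theory.

Local Open Scope classical_set_scope.
Local Open Scope ring_scope.

(** * Homomorphisms and generated subgroups *)

Definition is_hom (T U : groupType) (f : T -> U) :=
  {morph f : x y / (x * y)%g >-> (x * y)%g}.

Lemma hom1 (T U : groupType) (f : T -> U) : is_hom f -> f 1%g = 1%g.
Proof. by move=> fM; apply: (mulgI (f 1%g)); rewrite -fM !mulg1. Qed.

Lemma homV (T U : groupType) (f : T -> U) x : is_hom f -> f (x^-1)%g = ((f x)^-1)%g.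
Proof. by move=> fM; apply: (mulgI (f x)); rewrite -fM !mulgV hom1. Qed.

Lemma homX (T U : groupType) (f : T -> U) x n :
  is_hom f -> f (x ^+ n)%g = (f x ^+ n)%g.
Proof. by move=> fM; elim: n => [|n IH]; rewrite ?hom1// !expgS fM IH. Qed.

Section Generated.
Variables (T : groupType) (S : set T).

Lemma gen_group_sub : S `<=` gen_group S.
Proof. exact: sub_gen_smallest. Qed.

Lemma gen_group_min (B : set T) :
  B 1%g -> (forall x y, B x -> B y -> B (x * y^-1)%g) -> S `<=` B ->
  gen_group S `<=` B.
Proof. by move=> B1 BV SB; apply: smallest_sub. Qed.

Lemma gen_group1 : gen_group S 1%g.
Proof. by move=> B /= [[B1 _] _]. Qed.

Lemma gen_groupF x y : gen_group S x -> gen_group S y -> gen_group S (x * y^-1)%g.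
Proof. by move=> Sx Sy B /= CB; apply: CB.1.2; [exact: Sx|exact: Sy]. Qed.

Lemma gen_groupV x : gen_group S x -> gen_group S (x^-1)%g.
Proof.
by move=> Sx; rewrite -(mul1g x^-1%g); apply: gen_groupF (gen_group1) Sx.
Qed.

Lemma gen_groupM x y : gen_group S x -> gen_group S y -> gen_group S (x * y)%g.
Proof. by move=> Sx /gen_groupV Sy; rewrite -(invgK y); exact: gen_groupF. Qed.

End Generated.

Lemma group_iso_of_embedding (W T : groupType) (f : W -> T) (H : set T) :
  is_hom f -> injective f -> range f = H ->
  group_iso (fun x y : T => (x * y)%g) (fun x y : W => (x * y)%g) H [set: W].
Proof.
move=> fM fI fH.
have /choice[k kP] (h : T) : exists w : W, H h -> f w = h.
  have [|nH] := pselect (H h); last by exists 1%g.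
  by rewrite -fH => -[w _ <-]; exists w.
exists k; first split=> //.
- by move=> x y; rewrite !inE => Hx Hy e; rewrite -(kP x Hx) -(kP y Hy) e.
- move=> w _; exists (f w); first by rewrite -fH; exists w.
  by apply: fI; apply: kP; rewrite -fH; exists w.
- move=> x y Hx Hy; apply: fI; rewrite fM !kP//.
  move: Hx Hy; rewrite -fH => -[v _ <-] [w _ <-]; exists (v * w)%g => //.
Qed.

Lemma embedding_of_group_iso (W T : groupType) (H : set T) :
  H 1%g -> (forall x y, H x -> H y -> H (x * y)%g) ->
  group_iso (fun x y : T => (x * y)%g) (fun x y : W => (x * y)%g) H [set: W] ->
  exists f : W -> T, [/\ is_hom f, injective f & range f = H].
Proof.
move=> H1 HM [k [_ kI kS] kM].
have /choice[f fP] (w : W) : exists h, H h /\ k h = w.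
  by have [h Hh hw] := kS w I; exists h.
exists f; split.
- move=> v w; apply: kI; rewrite ?inE; first exact: (fP _).1.
    by apply: HM; exact: (fP _).1.
  by rewrite kM ?(fP _).2//; exact: (fP _).1.
- by move=> v w e; rewrite -(fP v).2 e (fP w).2.
- apply/seteqP; split=> [_ [w _ <-]|h Hh]; first exact: (fP w).1.
  exists (k h) => //; apply: kI; rewrite ?inE //; first exact: (fP _).1.
  exact: (fP _).2.
Qed.

(** * Wreath products *)

Section Wreath.
Variables L G : groupType.
Implicit Types (l : L) (x y z : G) (u v w : wreath L G).

Lemma lamp_subproof l x :
  finite_set [set y : G | (if y == x then l else 1%g) <> 1%g].
Proof.
apply: (@sub_finite_set _ _ [set x]); last exact: finite_set1.
by move=> y /=; case: eqP.
Qed.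

Definition lamp x l : wreath L G :=
  @Wreath L G (fun y => if y == x then l else 1%g) 1%g (lamp_subproof l x).

Definition shift x : wreath L G := @Wreath L G (fun=> 1%g) x (wreath_one_subproof L G).

Lemma lampM x : is_hom (lamp x).
Proof.
move=> l l'; apply: wreath_eq => [y|] /=; last by rewrite mulg1.
by rewrite invg1 mul1g; case: eqP; rewrite ?mulg1.
Qed.

Lemma shiftM : is_hom shift.
Proof. by move=> x y; apply: wreath_eq => [z|] //=; rewrite mulg1. Qed.

Lemma wr_topM : is_hom (@wr_top L G).
Proof. by []. Qed.

Lemma shift_lamp x y l :
  (shift x * lamp y l * (shift x)^-1)%g = lamp (x * y)%g l.
Proof.
apply: wreath_eq => [z|] /=; last by rewrite mulg1 mulgV.
rewrite mul1g invg1 mulg1; congr (if _ then _ else _).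
by apply/eqP/eqP => [<-|->]; rewrite ?mulKg ?mulVKg.
Qed.

(** Conjugation by an element of the base acts inside each copy of [L],
    which has no effect once [L] is abelian; only the shift of the index remains. *)
Lemma lamp_conj w x l : (forall l l', commute l l') ->
  (w * lamp x l * w^-1)%g = lamp (wr_top w * x)%g l.
Proof.
move=> LC; apply: wreath_eq => [z|] /=; last by rewrite mulg1 mulgV.
rewrite mulg1 mulVKg LC mulgA mulVg mul1g; congr (if _ then _ else _).
by apply/eqP/eqP => [<-|->]; rewrite ?mulKg ?mulVKg.
Qed.

Lemma base_commute u v : (forall l l', commute l l') ->
  wr_top u = 1%g -> wr_top v = 1%g -> commute u v.
Proof.
move=> LC u1 v1; apply: wreath_eq => [z|] /=; last by rewrite u1 v1.
by rewrite u1 v1 !invg1 !mul1g; exact: LC.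
Qed.

(** The base is generated by the lamps: the induction removes the indices of a
    finite list that contains the support. *)
Lemma base_ind (P : wreath L G -> Prop) :
  P 1%g -> (forall x l, P (lamp x l)) ->
  (forall u v, wr_top u = 1%g -> wr_top v = 1%g -> P u -> P v -> P (u * v)%g) ->
  forall u, wr_top u = 1%g -> P u.
Proof.
move=> P1 Pl PM u u1.
have /finite_seqP[r rE] := wr_finite u; have {rE} : forall x, wr_base u x <> 1%g -> x \in r.
  by move=> x ux; have : [set` r] x by rewrite -rE.
elim: r u u1 => [|y r IH] u u1 ur.
  rewrite (_ : u = 1%g)//; apply: wreath_eq => // x /=.
  by apply: contrapT => /ur.
rewrite -(mulVKg (lamp y (wr_base u y)) u); apply: PM => //=.
  by rewrite invg1 u1 mulg1.
apply: IH => /=; first by rewrite u1 invg1 mulg1.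
move=> x; rewrite invgK !mul1g; case: (x =P y) => [->|xy]; first by rewrite mulVg.
by rewrite invg1 mul1g => /ur; rewrite inE => /orP[/eqP|].
Qed.

Lemma wreath_decomp w : exists u, wr_top u = 1%g /\ w = (u * shift (wr_top w))%g.
Proof.
exists (@Wreath L G (wr_base w) 1%g (wr_finite w)); split=> //.
by apply: wreath_eq => [x|] /=; rewrite ?mulg1 ?mul1g.
Qed.

End Wreath.
Arguments shift {L G} x.

Lemma base_expg (L G : groupType) (w : wreath L G) x k :
  wr_top w = 1%g -> wr_base (w ^+ k)%g x = (wr_base w x ^+ k)%g.
Proof.
by move=> w1; elim: k => [|k IH] //; rewrite !expgS /= w1 invg1 mul1g IH.
Qed.

(** The group is not commutative, so that an iterated product depends on the
    enumeration of its index set in general; commutation of the factors suffices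
    to make it well defined on finite sets. *)
Lemma prod_commute_eq (T : groupType) (I : eqType) (r s : seq I) (F : I -> T) :
  (forall i j, commute (F i) (F j)) -> perm_eq r s ->
  (\prod_(i <- r) F i = \prod_(i <- s) F i)%g.
Proof.
move=> FC; elim: r s => [|x r IH] s.
  by rewrite perm_sym => /perm_nilP->.
move=> rs; have xs : x \in s by rewrite -(perm_mem rs) mem_head.
case/splitPr: xs rs => s1 s2; rewrite -[x :: s2]cat1s.
rewrite perm_sym perm_catCA perm_cons perm_sym.
move=> /IH e; rewrite big_cons e !big_cat big_cons /= !mulgA; congr (_ * _)%g.
by rewrite big_nil mulg1; apply: commute_prod => i _; exact: FC.
Qed.

Section BaseProduct.
Variables (L G T : groupType) (F : G -> L -> T).
Hypothesis FM : forall x, is_hom (F x).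
Hypothesis FC : forall x y l l', commute (F x l) (F y l').

(** A family of pairwise commuting homomorphisms from the copies of [L] extends
    to the base.  The order in which the support is enumerated is arbitrary. *)
Definition base_prod (u : wreath L G) : T :=
  (\prod_(x <- fset_set [set x | wr_base u x <> 1%g]) F x (wr_base u x))%g.

(** Enlarging the list of indices only adds trivial factors; two elements can
    thus be compared over a common list. *)
Lemma base_prodE (r : seq G) (u : wreath L G) :
  uniq r -> (forall x, wr_base u x <> 1%g -> x \in r) ->
  base_prod u = (\prod_(x <- r) F x (wr_base u x))%g.
Proof.
move=> ru ur.
have -> : (\prod_(x <- r) F x (wr_base u x) =
           \prod_(x <- r | wr_base u x != 1) F x (wr_base u x))%g.
  rewrite [RHS]big_mkcond; apply: eq_bigr => x _.
  by case: ifPn => // /negbNE/eqP->; rewrite hom1.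
rewrite -[RHS]big_filter; apply: prod_commute_eq => //.
apply: uniq_perm; [exact: fset_uniq|exact: filter_uniq|].
move=> x; rewrite in_fset_set; last exact: wr_finite.
rewrite mem_filter; apply/idP/andP; rewrite inE /=.
  by move=> h; split; [exact/eqP|exact: ur].
by case=> /eqP.
Qed.

Lemma base_prod_lamp x l : base_prod (lamp x l) = F x l.
Proof.
rewrite (@base_prodE [:: x])//=; first by rewrite big_seq1 eqxx.
by move=> y; case: eqP => [->|//]; rewrite mem_head.
Qed.

Lemma base_prodM u v :
  wr_top u = 1%g -> base_prod (u * v)%g = (base_prod u * base_prod v)%g.
Proof.
move=> u1.
pose r : seq G := (fset_set [set x | wr_base u x <> 1%g] `|`
                   fset_set [set x | wr_base v x <> 1%g])%fset.
have ru : uniq r by exact: fset_uniq.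
have inr x : x \in r = `[< wr_base u x <> 1%g >] || `[< wr_base v x <> 1%g >].
  rewrite in_fsetU !in_fset_set; try exact: wr_finite.
  by congr (_ || _); apply/idP/idP; rewrite ?inE => /asboolP.
rewrite (base_prodE (u := u) ru); last by move=> x /asboolP; rewrite inr => ->.
rewrite (base_prodE (u := v) ru); last first.
  by move=> x /asboolP; rewrite inr orbC => ->.
rewrite (base_prodE ru); last first.
  move=> x /=; rewrite u1 invg1 mul1g inr => e.
  apply/orP; have [ux|ux] := eqVneq (wr_base u x) 1%g; last first.
    by left; apply/asboolP/eqP.
  by right; apply/asboolP => vx; apply: e; rewrite ux vx mulg1.
rewrite -prodgM_commute; last by move=> *; exact: FC.
by apply: eq_bigr => x _ /=; rewrite u1 invg1 mul1g FM.
Qed.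

Lemma base_prod1 : base_prod 1%g = 1%g.
Proof. by apply: (mulgI (base_prod 1%g)); rewrite -base_prodM// !mulg1. Qed.

Lemma base_prodMr u x : base_prod (u * shift x)%g = base_prod u.
Proof.
have e y : wr_base (u * shift x)%g y = wr_base u y by rewrite /= mulg1.
rewrite (@base_prodE (fset_set [set x | wr_base u x <> 1%g])).
- by apply: eq_bigr => y _; rewrite e.
- exact: fset_uniq.
- by move=> y; rewrite e in_fset_set ?inE//; exact: wr_finite.
Qed.

Lemma base_prod_top x : base_prod (shift x) = 1%g.
Proof. by rewrite (@base_prodE [::])// big_nil. Qed.

End BaseProduct.

Section Recognition.
Variables (T L G : groupType) (io : L -> T) (rho : G -> T).
Hypotheses (ioM : is_hom io) (rhoM : is_hom rho).
Let c x l := (rho x * io l * (rho x)^-1)%g.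
Hypothesis cC : forall x y l l', commute (c x l) (c y l').
Hypothesis c_free : forall (r : seq G) (f : G -> L) a, uniq r ->
  (\prod_(x <- r) c x (f x))%g = rho a -> a = 1%g /\ forall x, x \in r -> f x = 1%g.

Let cM x : is_hom (c x).
Proof. by move=> l l'; rewrite /c ioM !mulgA mulgVK. Qed.

Let psi w := (base_prod c w * rho (wr_top w))%g.

Let base_prod_shift x u : wr_top u = 1%g ->
  base_prod c (shift x * u * (shift x)^-1)%g =
  (rho x * base_prod c u * (rho x)^-1)%g.
Proof.
move=> u1; move: u u1; apply: base_ind.
- by rewrite !mulg1 mulgV base_prod1// mulg1 mulgV.
- move=> y l; rewrite shift_lamp !base_prod_lamp// /c rhoM.
  by rewrite invgM !mulgA.
- move=> u v u1 v1 eu ev.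
  have -> : (shift x * (u * v) * (shift x)^-1 = (shift x * u * (shift x)^-1)
     * (shift x * v * (shift x)^-1))%g by rewrite !mulgA mulgVK.
  rewrite base_prodM//; last by rewrite /= u1 mulg1 mulgV.
  by rewrite eu ev base_prodM// !mulgA mulgVK.
Qed.

Let psiM : is_hom psi.
Proof.
move=> v w; rewrite /psi wr_topM.
have [u [u1 vE]] := wreath_decomp v; have [u' [u1' wE]] := wreath_decomp w.
set a := wr_top v in vE *; set b := wr_top w in wE *.
have -> : (v * w = u * (shift a * u' * (shift a)^-1) * shift (a * b))%g.
  by rewrite vE wE shiftM !mulgA mulgVK.
rewrite vE wE !base_prodMr// base_prodM// base_prod_shift// rhoM.
by rewrite !mulgA mulgVK.
Qed.

Let psi_inj : injective psi.
Proof.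
suff psi1 w : psi w = 1%g -> w = 1%g.
  move=> v w e; apply: divg1_eq; apply: psi1.
  by rewrite psiM homV// e mulgV.
move=> e0; have e : base_prod c w = rho (wr_top w)^-1%g.
  by rewrite homV//; apply: (mulIg (rho (wr_top w))); rewrite mulVg.
have [a1 f1] := c_free (fset_uniq _) e.
apply: wreath_eq => [x|] /=; last by rewrite -(invgK (wr_top w)) a1 invg1.
apply: contrapT => fx; apply/fx/f1; rewrite in_fset_set ?inE//; exact: wr_finite.
Qed.

(** The internal characterisation of a wreath product: conjugates of [L] by [G]
    commute, and are independent of each other and of [G].  The independence
    is exactly the injectivity of the map that sends [(f, a)] to the product of
    the conjugates of the [f x] by [x], times [a]. *)
Lemma wreath_recognition :
  exists f : wreath L G -> T,
    [/\ is_hom f, injective f & range f = gen_group (range rho `|` range io)].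
Proof.
exists psi; split=> //; apply/seteqP; split; last first.
  apply: gen_group_min.
  - by exists 1%g => //; rewrite hom1.
  - move=> _ _ [v _ <-] [w _ <-]; exists (v * w^-1)%g => //.
    by rewrite psiM (homV _ psiM).
  - move=> _ [[x _ <-]|[l _ <-]].
      by exists (shift x) => //; rewrite /psi base_prod_top// mul1g.
    exists (lamp 1%g l) => //.
    by rewrite /psi base_prod_lamp// /c /= hom1// invg1 mul1g !mulg1.
set H := gen_group _.
have Hrho x : H (rho x) by apply: gen_group_sub; left; exists x.
have Hio l : H (io l) by apply: gen_group_sub; right; exists l.
move=> _ [w _ <-]; apply: gen_groupM; last exact: Hrho.
apply: (big_ind H); [exact: gen_group1|by move=> y z Hy Hz; exact: (gen_groupM Hy Hz)|].
by move=> x _; exact: (gen_groupF (gen_groupM (Hrho _) (Hio _)) (Hrho _)).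
Qed.

End Recognition.

Lemma prod_lamps (L G : groupType) : (forall l l' : L, commute l l') ->
  exists p : wreath L G -> L,
    [/\ forall x l, p (lamp x l) = l &
        forall u v, wr_top u = 1%g -> p (u * v)%g = (p u * p v)%g].
Proof.
move=> LC; exists (base_prod (fun _ l => l)); split=> [x l|u v].
  exact: base_prod_lamp.
exact: base_prodM.
Qed.

(** The sum [p] identifies [L] with the coinvariants of the base: an invariant
    homomorphism from the base takes the same value at [b] and at
    [lamp 1 (p b)].  Hence sending [l] to the sum of the image of
    [lamp 1 l], and the same map in the other direction, are inverse bijections. *)
Lemma wreath_lamp_iso (L1 G1 L2 G2 : groupType)
    (f : wreath L1 G1 -> wreath L2 G2) (g : wreath L2 G2 -> wreath L1 G1) :
  (forall l l' : L1, commute l l') -> (forall l l' : L2, commute l l') ->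
  is_hom f -> is_hom g -> cancel f g -> cancel g f ->
  (forall w, wr_top w = 1%g <-> wr_top (f w) = 1%g) ->
  exists h : L1 -> L2, is_hom h /\ bijective h.
Proof.
move=> LC1 LC2 fM gM fK gK fb.
have gb w : wr_top w = 1%g <-> wr_top (g w) = 1%g by rewrite fb gK.
(* An invariant homomorphism of the base factors through the sum. *)
have key L1' G1' L2' G2' (f' : wreath L1' G1' -> wreath L2' G2') p1 p2 :
    (forall l l' : L1', commute l l') -> (forall l l' : L2', commute l l') ->
    is_hom f' -> (forall w, wr_top w = 1%g -> wr_top (f' w) = 1%g) ->
    (forall x l, p1 (lamp x l) = l) ->
    (forall u v, wr_top u = 1%g -> p1 (u * v)%g = (p1 u * p1 v)%g) ->
    (forall x l, p2 (lamp x l) = l) ->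
    (forall u v, wr_top u = 1%g -> p2 (u * v)%g = (p2 u * p2 v)%g) ->
    forall u, wr_top u = 1%g -> p2 (f' u) = p2 (f' (lamp 1%g (p1 u))).
  move=> C1 C2 f'M f'b p1l p1M p2l p2M.
  have p21 : p2 1%g = 1%g by apply: (mulgI (p2 1%g)); rewrite -p2M// !mulg1.
  have p11 : p1 1%g = 1%g by apply: (mulgI (p1 1%g)); rewrite -p1M// !mulg1.
  have p2J w u : wr_top u = 1%g -> p2 (w * u * w^-1)%g = p2 u.
    move: u; apply: base_ind => [|x l|u v u1 v1 eu ev].
    - by rewrite mulg1 mulgV.
    - by rewrite lamp_conj// !p2l.
    - have -> : (w * (u * v) * w^-1 = (w * u * w^-1) * (w * v * w^-1))%g.
        by rewrite !mulgA mulgVK.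
      rewrite p2M; first by rewrite eu ev p2M.
      by rewrite /= u1 mulg1 mulgV.
  apply: base_ind => [|x l|u v u1 v1 eu ev].
  - by rewrite p11 (hom1 (lampM _)).
  - rewrite p1l -[x in LHS]mulg1 -shift_lamp !f'M homV//.
    by rewrite p2J //; apply: f'b.
  - by rewrite f'M p2M ?f'b// eu ev p1M// lampM f'M p2M ?f'b.
have [p1 [p1l p1M]] := prod_lamps G1 LC1.
have [p2 [p2l p2M]] := prod_lamps G2 LC2.
exists (fun l => p2 (f (lamp 1%g l))); split.
  by move=> l l'; rewrite lampM fM p2M//; apply/fb.
have fb1 w : wr_top w = 1%g -> wr_top (f w) = 1%g by move/fb.
have gb1 w : wr_top w = 1%g -> wr_top (g w) = 1%g by move/gb.
exists (fun l => p1 (g (lamp 1%g l))) => l.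
  by rewrite -(key _ _ _ _ g p2 p1)// ?fK ?p1l//; exact: fb1.
by rewrite -(key _ _ _ _ f p1 p2)// ?gK ?p2l//; exact: gb1.
Qed.

(** A central element of the base has a constant family of coordinates, and
    its support is finite. *)
Lemma wreath_center (L G : groupType) (w : wreath L G) (x : nat -> G) :
  injective x -> wr_top w = 1%g ->
  (forall v, commute v w) -> w = 1%g.
Proof.
move=> xI w1 wC; apply: wreath_eq => // z /=.
have wE y : wr_base w (y * z)%g = wr_base w z.
  have /(congr1 (fun u => wr_base u (y * z)%g)) /= := wC (shift y).
  by rewrite mul1g mulKg mulg1.
apply: contrapT => wz; apply: infinite_nat.
have : finite_set [set n | wr_base w (x n) <> 1%g].
  by apply: finite_preimage (wr_finite w) => n m _ _ /xI.
rewrite (_ : [set n | _] = setT)//; apply/seteqP; split=> // n _ /=.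
by rewrite -(mulgVK z (x n)) wE.
Qed.

(** * Free abelian groups, written multiplicatively *)

(** The matrices carry an additive structure, whereas wreath products are built
    on multiplicative groups. *)
Definition lattice (k : nat) : Type := 'rV[int]_k.
HB.instance Definition _ k := Choice.copy (lattice k) 'rV[int]_k.
HB.instance Definition _ k := isGroup.Build (lattice k)
  (@addrA 'rV[int]_k) (@add0r 'rV[int]_k) (@addr0 'rV[int]_k)
  (@addNr 'rV[int]_k) (@addrN 'rV[int]_k).

Lemma lattice_torsion_free_infinite (G : groupType) (k : nat) (theta : G -> 'rV[int]_k) :
  (0 < k)%N -> set_bij [set: G] [set: 'rV[int]_k] theta ->
  {morph theta : x y / (x * y)%g >-> x + y} ->
  (forall (x : G) j, (x ^+ j.+1 = 1)%g -> x = 1%g) /\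
  (exists xs : nat -> G, injective xs).
Proof.
move=> k0 [_ thI thS] thM.
have th1 : theta 1%g = 0 by apply: (addrI (theta 1%g)); rewrite -thM mulg1 addr0.
have thX x j : theta (x ^+ j)%g = theta x *+ j.
  by elim: j => [|j IH]; rewrite ?expg0// expgS thM IH mulrS.
split=> [x j e|].
  apply: thI; rewrite ?inE//; apply/rowP => i.
  have /(congr1 (fun v : 'rV_k => v 0 i)) := thX x j.+1.
  rewrite e th1 mulmxnE mxE => /esym/eqP; rewrite mulrn_eq0 => /eqP ->.
  by [].
have /choice[xs xsP] (j : nat) : exists x, theta x = const_mx j%:Z.
  by have [x _ xE] := thS (const_mx j%:Z) I; exists x.
exists xs => i j e; have := xsP i; rewrite e xsP => /rowP/(_ (Ordinal k0)).
by rewrite !mxE => -[].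
Qed.

(** * The circle and its interval exchanges *)

Section Circle.
Variable R : realType.
Implicit Types (x y : R) (p a b : circle R).

Lemma mod1D x y : mod1 (x + y) = mod1 x + mod1 y.
Proof.
apply: mod1_eq; have := rpredD (mod1_int x) (mod1_int y).
set v := val (mod1 x); set w := val (mod1 y) => h.
by rewrite -rpredN opprB [_ - _](_ : _ = x - v + (y - w))//; lra.
Qed.

Lemma mod1N x : mod1 (- x) = - mod1 x.
Proof.
by apply/eqP; rewrite -addr_eq0 -mod1D addNr; apply/eqP.
Qed.

Lemma mod10 : mod1 0 = 0 :> circle R.
Proof. by []. Qed.

Lemma mod1Mn x k : mod1 (x *+ k) = mod1 x *+ k.
Proof. by elim: k => [|k IH]; rewrite ?mulr0n// !mulrS mod1D IH. Qed.

Lemma mod1_eq0 x : mod1 x = 0 <-> x \is a Num.int.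
Proof.
split=> [h|xi]; last by rewrite -mod10; apply: mod1_eq; rewrite sub0r rpredN.
by have := mod1_int x; rewrite h -mod10 mod1_id ?lexx ?ltr01// subr0.
Qed.

Lemma iet_inj (h : IET R) : injective h.
Proof. by case: (ietP h) => /bij_inj. Qed.

Lemma rotationD a b : rotation (a + b) = (rotation a * rotation b)%g.
Proof. by apply: iet_eq => p /=; rewrite addrA addrAC. Qed.

Lemma rotation0 : rotation 0 = 1%g :> IET R.
Proof. by apply: iet_eq => p /=; rewrite addr0. Qed.

Lemma rotationN a : rotation (- a) = ((rotation a)^-1)%g.
Proof.
by apply: (mulgI (rotation a)); rewrite -rotationD subrr rotation0 mulgV.
Qed.

(** The intervals of an exchange are closed on the left. *)
Lemma iet_right_translation (h : IET R) p :
  exists2 e : R, 0 < e &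
    forall t : R, 0 <= t < e -> h (p + mod1 t) = h p + mod1 t.
Proof.
have [I [a [b [t [r1 c1 _ t1]]]]] := piecewise_translationE (ietP h).2.
have [i /andP[ap pb]] := c1 p.
exists (b i - val p); first by rewrite subr_gt0.
move=> e /andP[e0 eb].
have hi : a i <= val p + e < b i by apply/andP; split; lra.
have -> : p + mod1 e = Circle (r1 _ _ hi).
  transitivity (mod1 (val p + e)); first by rewrite mod1D mod1_val.
  by apply: val_inj; rewrite mod1_id //; exact: r1 hi.
have hp : a i <= val p < b i by rewrite ap.
have hv := t1 i (Circle (r1 _ _ hi)) hi.
transitivity (mod1 (val (h p) + e)); last by rewrite mod1D mod1_val.
rewrite -[LHS]mod1_val hv (t1 i p hp); congr mod1.
by rewrite /= addrAC.
Qed.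

End Circle.

(** * Cells and fibres *)

Section Cells.
Variables (R : realType) (n : nat).
Local Notation q := n.+1.
Implicit Types (p a : circle R) (h : IET R) (s t : 'S_q).

Definition unit_step : circle R := mod1 (q%:R^-1).
Local Notation u := unit_step.
Local Notation sigma := (cycle_perm q).

Lemma stepE k : u *+ k = mod1 (k%:R / q%:R).
Proof. by rewrite mulr_natl mod1Mn. Qed.

Lemma step_order : u *+ q = 0.
Proof. by rewrite stepE divff ?pnatr_eq0//; apply/mod1_eq0; rewrite rpred1. Qed.

Lemma step_mod k : u *+ (k %% q) = u *+ k.
Proof.
by rewrite [in RHS](divn_eq k q) mulrnDr mulnC mulrnA step_order mul0rn add0r.
Qed.

(** [cell] without the option: a cell exists since [q] is positive, so that the
    default value is never taken. *)
Definition cell_of p : 'I_q := odflt ord0 (cell q p).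

Lemma cell_some p : cell q p = Some (cell_of p).
Proof. by rewrite /cell_of; have [i ->] := cell_ex p (ltn0Sn n). Qed.

Lemma cell_ofP p (i : 'I_q) :
  cell_of p = i <-> i%:R / q%:R <= val p < i.+1%:R / q%:R.
Proof. by rewrite -cellP cell_some; split=> [->//|/eqP[]]. Qed.

Lemma cell_of_step (i : 'I_q) : cell_of (u *+ i) = i.
Proof.
have q0 : 0 < q%:R :> R by rewrite ltr0n.
have i01 : 0 <= (i%:R / q%:R : R) < 1.
  by rewrite divr_ge0 //= ltr_pdivrMr// mul1r ltr_nat.
by apply/cell_ofP; rewrite stepE mod1_id// lexx ltr_pM2r ?invr_gt0// ltr_nat /=.
Qed.

Lemma step_inj : injective (fun i : 'I_q => u *+ i).
Proof. by move=> i j e; rewrite -(cell_of_step i) e cell_of_step. Qed.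

Lemma sigma_val (i : 'I_q) : sigma i = (i.+1 %% q)%N :> nat.
Proof. by rewrite permE. Qed.

Lemma step_sigma (i : 'I_q) : u *+ sigma i = u *+ i + u.
Proof. by rewrite sigma_val step_mod mulrSr. Qed.

Lemma step_sigmaX k (i : 'I_q) : u *+ (sigma ^+ k)%g i = u *+ i + u *+ k.
Proof.
elim: k => [|k IH]; first by rewrite expg0 perm1 addr0.
by rewrite expgSr permM step_sigma IH mulrSr addrA.
Qed.

Lemma sigmaX_ord (i j : 'I_q) : (sigma ^+ i)%g j = (sigma ^+ j)%g i.
Proof. by apply: step_inj; rewrite !step_sigmaX addrC. Qed.

(** The last cell wraps around to the first. *)
Lemma cell_of_addu p : cell_of (p + u) = sigma (cell_of p).
Proof.
have /cell_ofP h := erefl (cell_of p).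
have e : p + u = mod1 (val p + q%:R^-1) by rewrite mod1D mod1_val.
have qi0 : 0 < q%:R^-1 :> R by rewrite invr_gt0 ltr0n.
have qi1 : q%:R / q%:R = 1 :> R by rewrite divff ?pnatr_eq0.
have le1 (k : nat) : (k <= q)%N -> k%:R / q%:R <= 1 :> R.
  by move=> kq; rewrite ler_pdivrMr ?ltr0n// mul1r ler_nat.
apply/cell_ofP; rewrite sigma_val.
move: h qi0 qi1 e le1; move: (q%:R^-1 : R) => qi /andP[h1 h2] qi0 qi1 e le1.
have nS (k : nat) : k.+1%:R * qi = k%:R * qi + qi by rewrite -natr1 mulrDl mul1r.
have m0 : 0 <= (cell_of p)%:R * qi by rewrite mulr_ge0// ltW.
rewrite nS in h2; have [ci|ci] := ltnP (cell_of p).+1 q.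
  have := le1 _ ci; rewrite modn_small// !nS e => h3.
  by rewrite mod1_id; apply/andP; split; lra.
have cE : (cell_of p).+1 = q by apply/eqP; rewrite eqn_leq ci ltn_ord.
rewrite -cE nS in qi1.
have -> : p + u = mod1 (val p + qi - 1).
  rewrite e; apply: mod1_eq; rewrite [_ - _](_ : _ = -1) ?rpredN ?rpred1//; lra.
rewrite cE modnn nS mul0r add0r.
by rewrite mod1_id; apply/andP; split; lra.
Qed.

Lemma cell_of_addX p k : cell_of (p + u *+ k) = (sigma ^+ k)%g (cell_of p).
Proof.
elim: k => [|k IH]; first by rewrite addr0 expg0 perm1.
by rewrite mulrSr addrA cell_of_addu IH expgSr permM.
Qed.

Lemma block_ietE t p : block_iet R t p = p + u *+ t (cell_of p) - u *+ cell_of p.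
Proof.
rewrite /= /block_fun cell_some mulrBl mod1D mod1D mod1_val mod1N -!stepE addrA.
by [].
Qed.

Lemma cell_of_block t p : cell_of (block_iet R t p) = t (cell_of p).
Proof. by have [_] := block_funE t (cell_some p); rewrite cell_some => -[]. Qed.

Lemma block_ietM t s : (block_iet R t * block_iet R s = block_iet R (s * t))%g.
Proof.
apply: iet_eq => p.
rewrite [LHS](_ : _ = block_iet R t (block_iet R s p)) // [LHS]block_ietE cell_of_block.
by rewrite !block_ietE permM addrAC [p + _ - _ - _]addrAC addrK addrAC.
Qed.

Lemma block_iet1 : block_iet R (1%g : 'S_q) = 1%g.
Proof. by apply: iet_eq => p; rewrite block_ietE perm1 addrK. Qed.

Lemma block_ietV t : (block_iet R t)^-1%g = block_iet R t^-1%g.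
Proof.
by apply: (mulgI (block_iet R t)); rewrite block_ietM mulVg block_iet1 mulgV.
Qed.

(** [s] describes the action of [h] on the fibre of [p], whose points are
    numbered by the multiples of [u] that separate them from [p]. *)
Definition fibre_perm h p s := forall i : 'I_q, h (p + u *+ i) = p + u *+ s i.

Lemma fibre_perm_uniq h p s t : fibre_perm h p s -> fibre_perm h p t -> s = t.
Proof.
move=> hs ht; apply/permP => i; apply: step_inj; apply: (addrI p).
by rewrite -hs ht.
Qed.

(** Products of permutations are composed from left to right, those of interval
    exchanges from right to left. *)
Lemma fibre_permM h k p s t :
  fibre_perm h p s -> fibre_perm k p t -> fibre_perm (h * k)%g p (t * s)%g.
Proof.
by move=> hs kt i; rewrite permM -hs -kt.
Qed.

Lemma fibre_perm1 p : fibre_perm 1%g p 1%g.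
Proof. by move=> i; rewrite perm1. Qed.

Lemma eq_fibre_perm h k :
  (forall p, exists s, fibre_perm h p s /\ fibre_perm k p s) -> h = k.
Proof.
move=> hk; apply: iet_eq => p; have [s [hs ks]] := hk p.
by rewrite -[p]addr0 -(mulr0n u) (hs ord0) (ks ord0).
Qed.

Lemma fibre_perm_rotation h a p s : fibre_perm h (p - a) s ->
  fibre_perm (rotation a * h * (rotation a)^-1)%g p s.
Proof.
move=> hs i; rewrite -rotationN.
rewrite [LHS](_ : _ = h (p + u *+ i - a) + a) // addrAC hs.
by rewrite addrAC subrK.
Qed.

(** Numbering the points of a fibre from [p] instead of from its point in cell 0
    conjugates by a power of sigma. *)
Definition fibre_symbol p t : 'S_q := (t ^ (sigma ^- cell_of p))%g.

Lemma fibre_perm_block p t : fibre_perm (block_iet R t) p (fibre_symbol p t).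
Proof.
move=> i; rewrite block_ietE cell_of_addX sigmaX_ord.
set c := cell_of p; rewrite /fibre_symbol conjgE invgK permM permM.
set j := t _; have e : u *+ (sigma ^- c)%g j = u *+ j - u *+ c.
  by apply: (addIr (u *+ c)); rewrite -step_sigmaX permKV subrK.
by rewrite e step_sigmaX opprD -[p + _ + _]addrA [u *+ i + _]addrC !addrA addrK.
Qed.

Lemma cell_of0 : cell_of 0 = ord0.
Proof. by rewrite -(cell_of_step ord0) mulr0n. Qed.

Lemma block_iet_inj : injective (@block_iet R q).
Proof.
move=> s t e; have := fibre_perm_block 0 s.
rewrite e => /fibre_perm_uniq/(_ (fibre_perm_block 0 t)).
by rewrite /fibre_symbol cell_of0 expg0 invg1 !conjg1.
Qed.

(** * Drift *)

(** [h] acts on the circle of fibres as the rotation by [a]; belonging to <u> is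
    expressed as being killed by [q]. *)
Definition drift h a := forall p, (h p - p - a) *+ q = 0.

(** The [q]-torsion of the circle is <u>. *)
Lemma torsion_step p : p *+ q = 0 -> exists i : 'I_q, p = u *+ i.
Proof.
move=> pq; have /andP[x0 x1] := circle_valP p.
have q0 : 0 < q%:R :> R by rewrite ltr0n.
have : mod1 (q%:R * val p) = 0 by rewrite mulr_natl mod1Mn mod1_val.
move=> /mod1_eq0 pqi; have : q%:R * val p \is a Num.nat.
  by rewrite natrEint pqi mulr_ge0// ltW.
case/natrP=> k kE; have kq : (k < q)%N by rewrite -(ltr_nat R) -kE gtr_pMr.
exists (Ordinal kq); rewrite stepE /= -kE mulrC mulKf ?mod1_val//.
by rewrite pnatr_eq0.
Qed.

Lemma drift_fibre_perm h p : drift h 0 -> exists s, fibre_perm h p s.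
Proof.
move=> h0; have /choice[f fP] (i : 'I_q) :
    exists j : 'I_q, h (p + u *+ i) = p + u *+ j.
  have [j jE] := torsion_step (h0 (p + u *+ i)).
  exists ((sigma ^+ j)%g i); rewrite step_sigmaX addrA -jE subr0.
  by rewrite addrC subrK.
have fI : injective f.
  move=> i j e; apply/step_inj/(addrI p)/(@iet_inj _ h).
  by rewrite !fP e.
by exists (perm fI) => i; rewrite permE.
Qed.

Lemma fibre_permX h p s k : fibre_perm h p s -> fibre_perm (h ^+ k)%g p (s ^+ k)%g.
Proof.
move=> hs; elim: k => [|k IH]; first exact: fibre_perm1.
by rewrite expgS expgSr; exact: fibre_permM.
Qed.

Lemma fibre_permV h p s : fibre_perm h p s -> fibre_perm h^-1%g p s^-1%g.
Proof.
move=> hs i; rewrite -[in LHS](permKV s i) -hs.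
by rewrite [LHS](_ : _ = (h^-1 * h)%g (p + u *+ (s^-1)%g i)) // mulVg.
Qed.

(** The order of the symmetric group kills the permutation of every fibre. *)
Lemma drift_torsion h : drift h 0 -> (h ^+ #|[set: 'S_q]%SET| = 1)%g.
Proof.
move=> h0; apply: eq_fibre_perm => p; have [s hs] := drift_fibre_perm p h0.
exists 1%g; split; last exact: fibre_perm1.
have := fibre_permX #|[set: 'S_q]%SET| hs; rewrite (_ : s ^+ _ = 1)%g //.
by apply: expg_cardG; rewrite inE.
Qed.

Lemma driftM h k a b : drift h a -> drift k b -> drift (h * k)%g (a + b).
Proof.
move=> ha kb p.
have -> : (h * k)%g p - p - (a + b) = (h (k p) - k p - a) + (k p - p - b).
  rewrite [(h * k)%g p]/(h (k p)) opprD !addrA; congr (_ - _).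
  by rewrite [_ - a + _]addrAC subrK addrAC.
by rewrite mulrnDl ha kb addr0.
Qed.

Lemma driftV h a : drift h a -> drift h^-1%g (- a).
Proof.
move=> ha p; have hp : h (h^-1%g p) = p.
  by rewrite [LHS](_ : _ = (h * h^-1)%g p) // mulgV.
have := ha (h^-1%g p); rewrite hp => e.
by apply/eqP; rewrite -oppr_eq0 -mulNrn opprD opprB opprK e.
Qed.

Lemma drift_uniq h a b : drift h a -> drift h b -> (a - b) *+ q = 0.
Proof.
move=> ha hb; rewrite [a - b](_ : _ = (h 0 - 0 - b) - (h 0 - 0 - a)).
  by rewrite mulrnBl ha hb subr0.
by move: (h 0 - 0) => x; rewrite opprB [RHS]addrC addrA subrK.
Qed.

Lemma drift_conj h k a : drift k a -> drift h 0 -> drift (k * h * k^-1)%g 0.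
Proof.
by move=> ka h0; rewrite -(subrr a) -[X in X - a]addr0; apply/driftM/driftV/ka/driftM.
Qed.

Lemma drift_rotation a : drift (rotation a) a.
Proof.
move=> p; rewrite [rotation a p](_ : _ = p + a)//.
by rewrite addrAC addrK subrr mul0rn.
Qed.

Lemma drift_block t : drift (block_iet R t) 0.
Proof.
move=> p; rewrite block_ietE subr0 addrAC [_ - p]addrAC subrr add0r mulrnBl.
by rewrite -!mulrnA !(mulnC _ q) !mulrnA step_order !mul0rn subrr.
Qed.

Lemma drift1 : drift 1%g 0.
Proof. by move=> p; rewrite [(1%g : IET R) p](_ : _ = p)// subrr subr0 mul0rn. Qed.

(** * Conjugates of block permutations by rotations *)

(** Cells are closed on the left: moving slightly to the left changes the cell
    only from a boundary, that is, from a point of <u>. *)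
Lemma cell_of_left p : p *+ q != 0 -> exists2 e : R, 0 < e &
  forall d : R, 0 <= d < e -> cell_of (p - mod1 d) = cell_of p.
Proof.
move=> pq; have /cell_ofP/andP[c1 c2] := erefl (cell_of p).
have /andP[p0 p1] : 0 <= val p < 1 := circle_valP p.
(* The distance to the left end of the cell. *)
exists (val p - (cell_of p)%:R / q%:R).
  rewrite subr_gt0 lt_neqAle c1 andbT; apply: contra pq => /eqP e.
  by rewrite -[p]mod1_val -e -stepE -mulrnA mulnC mulrnA step_order mul0rn.
move=> d /andP[d0 d1]; apply/cell_ofP.
have m0 : 0 <= (cell_of p)%:R / q%:R :> R by rewrite divr_ge0.
have -> : p - mod1 d = mod1 (val p - d) by rewrite mod1D mod1N mod1_val.
move: c1 c2 d1 m0; move: (_.+1%:R / _ : R) ((cell_of p)%:R / _ : R) => x y c1 c2 d1 m0.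
by rewrite mod1_id; apply/andP; split; lra.
Qed.

Lemma cell_of_left_seq (r : seq (circle R)) : {in r, forall p, p *+ q != 0} ->
  exists2 e : R, 0 < e &
  forall d : R, 0 <= d < e -> {in r, forall p, cell_of (p - mod1 d) = cell_of p}.
Proof.
elim: r => [|p r IH] rq; first by exists 1.
have [|e e0 eP] := IH; first by move=> x xr; apply: rq; rewrite inE xr orbT.
have [|e' e0' eP'] := @cell_of_left p; first by apply: rq; rewrite mem_head.
exists (Num.min e e'); first by rewrite lt_min e0.
move=> d /andP[d0]; rewrite lt_min => /andP[de de'] x.
rewrite inE => /orP[/eqP->|xr]; first by rewrite eP'// d0.
by rewrite eP// d0.
Qed.

Lemma sigmaX_order : (sigma ^+ q = 1)%g.
Proof.
apply/permP => i; apply: step_inj.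
by rewrite step_sigmaX step_order addr0 perm1.
Qed.

(** Just to the left of 0 lies the last cell, with index [q - 1], and
    sigma ^- (q - 1) = sigma. *)
Lemma fibre_symbol_left t (d : R) : 0 < d <= q%:R^-1 ->
  fibre_symbol (- mod1 d) t = (t ^ sigma)%g.
Proof.
move=> /andP[d0 d1].
have qi1 : q%:R^-1 <= 1 :> R by rewrite invf_le1 ?ltr0n// ler1n.
have : sigma (cell_of (- mod1 d)) = ord0.
  rewrite -cell_of_addu addrC -mod1N -mod1D; apply/cell_ofP.
  move: d1 qi1; move: (_^-1 : R) => y d1 qi1.
  by rewrite mul0r mul1r mod1_id; apply/andP; split; lra.
move=> /(congr1 val); rewrite /= sigma_val => e.
rewrite /fibre_symbol; congr (_ ^ _)%g; apply: invg_inj; rewrite invgK.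
apply: (mulIg sigma); rewrite mulVg -expgSr.
by rewrite -(expg_mod _ sigmaX_order) e.
Qed.

Lemma fibre_symbol_conj_group p t (Q : set (IET R)) :
  t \in symbols q Q -> fibre_symbol p t \in conj_group q Q.
Proof.
move=> tQ; apply: mem_gen; apply/bigcupP.
have cq : ((q - cell_of p) %% q < q)%N by rewrite ltn_mod.
exists (Ordinal cq) => //=; rewrite (expg_mod _ sigmaX_order).
rewrite /fibre_symbol (_ : sigma ^- cell_of p = sigma ^+ (q - cell_of p))%g.
  by rewrite memJ_conjg.
apply: (mulIg (sigma ^+ cell_of p)%g); rewrite mulVg -expgD subnK ?sigmaX_order//.
exact/ltnW/ltn_ord.
Qed.

Definition same_fibre_perm h p p' := exists s, fibre_perm h p s /\ fibre_perm h p' s.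

Lemma same_fibre_perm1 p p' : same_fibre_perm 1%g p p'.
Proof. by exists 1%g; split; exact: fibre_perm1. Qed.

Lemma same_fibre_permM h k p p' :
  same_fibre_perm h p p' -> same_fibre_perm k p p' ->
  same_fibre_perm (h * k)%g p p'.
Proof.
by case=> s [? ?] [t [? ?]]; exists (t * s)%g; split; exact: fibre_permM.
Qed.

Lemma same_fibre_permV h p p' : same_fibre_perm h p p' -> same_fibre_perm h^-1%g p p'.
Proof. by case=> s [? ?]; exists s^-1%g; split; exact: fibre_permV. Qed.

Definition conj_block a t := (rotation a * block_iet R t * (rotation a)^-1)%g.

Lemma fibre_perm_conj_block a t p :
  fibre_perm (conj_block a t) p (fibre_symbol (p - a) t).
Proof. exact/fibre_perm_rotation/fibre_perm_block. Qed.

Lemma drift_conj_block a t : drift (conj_block a t) 0.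
Proof. exact/drift_conj/drift_block/drift_rotation. Qed.

Lemma conj_block_commute a b s t (Q : set (IET R)) :
  abelian (conj_group q Q) -> s \in symbols q Q -> t \in symbols q Q ->
  commute (conj_block a s) (conj_block b t).
Proof.
move=> /centsP Vab sQ tQ; apply: eq_fibre_perm => p.
exists (fibre_symbol (p - b) t * fibre_symbol (p - a) s)%g.
split; first by apply: fibre_permM; exact: fibre_perm_conj_block.
rewrite Vab; try exact: fibre_symbol_conj_group.
by apply: fibre_permM; exact: fibre_perm_conj_block.
Qed.

(** At the fibre of [a y] only the factor [conj_block (a y) (f y)] can jump,
    from [f y ^ sigma] on the left to [f y]; the trivial product has no jump. *)
Lemma conj_block_free (I : eqType) (r : seq I) (a : I -> circle R)
    (f : I -> 'S_q) :
  uniq r -> {in r &, forall x y, (a x - a y) *+ q = 0 -> x = y} ->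
  (\prod_(x <- r) conj_block (a x) (f x) = 1)%g ->
  {in r, forall x, commute (f x) sigma}.
Proof.
move=> ru ra r1 y yr; case/splitPr: yr ru ra r1 => r1 r2.
rewrite cat_uniq /= => /and3P[_ + /andP[yr2 _]] ra; rewrite negb_or => /andP[yr1 _].
rewrite big_cat big_cons /= => e.
have [|d d0 dP] := @cell_of_left_seq [seq a y - a x | x <- r1 ++ r2].
  move=> _ /mapP[x xr ->]; apply/eqP => /ra xy.
  have xy' : y = x.
    apply: xy; rewrite mem_cat inE ?eqxx ?orbT//.
    by move: xr; rewrite mem_cat => /orP[]->; rewrite ?orbT.
  by move: xr; rewrite -xy' mem_cat (negbTE yr1) (negbTE yr2).
have qi0 : 0 < q%:R^-1 :> R by rewrite invr_gt0 ltr0n.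
(* Positive, less than [d], and at most the length of a cell. *)
pose t := Num.min (d / 2%:R) q%:R^-1.
have t0 : 0 < t by rewrite lt_min qi0 divr_gt0.
have td : t < d by rewrite gt_min; apply/orP; left; lra.
have tq : t <= q%:R^-1 by rewrite ge_min lexx orbT.
have ag x : x \in r1 ++ r2 ->
    same_fibre_perm (conj_block (a x) (f x)) (a y) (a y - mod1 t).
  move=> xr; exists (fibre_symbol (a y - a x) (f x)); split.
    exact: fibre_perm_conj_block.
  suff -> : fibre_symbol (a y - a x) (f x) =
            fibre_symbol (a y - mod1 t - a x) (f x) by exact: fibre_perm_conj_block.
  rewrite [a y - _ - _]addrAC /fibre_symbol dP ?(ltW t0)//.
  exact: map_f.
have agp w : {subset w <= r1 ++ r2} ->
    same_fibre_perm (\prod_(x <- w) conj_block (a x) (f x))%g (a y) (a y - mod1 t).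
  elim: w => [|x w IH] sr; first by rewrite big_nil; exact: same_fibre_perm1.
  rewrite big_cons; apply: same_fibre_permM.
    by apply: ag; apply: sr; rewrite mem_head.
  by apply: IH => z zr; apply: sr; rewrite inE zr orbT.
have [] : same_fibre_perm (conj_block (a y) (f y)) (a y) (a y - mod1 t).
  move: e; set P1 := (\prod_(i <- r1) _)%g; set P2 := (\prod_(i <- r2) _)%g => e.
  have -> : conj_block (a y) (f y) = (P1^-1 * P2^-1)%g.
    apply: (mulgI P1); rewrite mulVKg; apply: (mulIg P2).
    by rewrite mulVg -mulgA.
  by apply: same_fibre_permM; apply/same_fibre_permV/agp => x;
    rewrite mem_cat => ->; rewrite ?orbT.
move=> s [s1 s2].
have e1 := fibre_perm_uniq s1 (fibre_perm_conj_block _ _ _).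
have e2 := fibre_perm_uniq s2 (fibre_perm_conj_block _ _ _).
move: e2; rewrite e1 subrr addrAC subrr sub0r fibre_symbol_left ?t0//.
rewrite /fibre_symbol cell_of0 expg0 invg1 conjg1 => {}e.
by rewrite /commute [LHS]conjgC -e.
Qed.

End Cells.

(** * The group generated by rotations and block permutations *)

Lemma pigeonhole_nat (T : finType) (F : nat -> T) : exists i j, i <> j /\ F i = F j.
Proof.
have /injectivePn[i [j ij e]] : ~~ injectiveb (fun i : 'I_#|T|.+1 => F i).
  by apply/injectiveP => /leq_card; rewrite card_ord ltnn.
by exists i, j; split=> // /val_inj/eqP; rewrite (negbTE ij).
Qed.

Section Main.
Variables (R : realType) (s m n : nat).
Variables (alpha : 'I_s -> circle R) (g : 'I_m -> IET R).
Local Notation q := n.+1.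
Local Notation u := (unit_step R n).
Local Notation sigma := (cycle_perm q).
Local Notation drift := (@drift R n).
Local Notation conj_block := (@conj_block R n).
Hypothesis alphaI : Q_independent alpha.
Hypothesis gQ : forall j, block_group q (g j).

Definition angle (v : 'rV[int]_s) : circle R := \sum_i alpha i *~ v 0 i.

Lemma angleD v w : angle (v + w) = angle v + angle w.
Proof. by rewrite /angle -big_split; apply: eq_bigr => i _ /=; rewrite mxE mulrzDr. Qed.

Lemma angle0 : angle 0 = 0.
Proof. by apply: (addrI (angle 0)); rewrite -angleD !addr0. Qed.

Lemma angleN v : angle (- v) = - angle v.
Proof. by apply: (addrI (angle v)); rewrite -angleD !subrr angle0. Qed.

Lemma angleMn v k : angle (v *+ k) = angle v *+ k.
Proof. by elim: k => [|k IH]; rewrite ?mulr0n ?angle0// !mulrS angleD IH. Qed.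

(** This contains both the freeness of A and the triviality of its intersection
    with <u>. *)
Lemma angle_torsion v k : angle v *+ k.+1 = 0 -> v = 0.
Proof.
rewrite -angleMn => /alphaI v0; apply/rowP => i; rewrite mxE.
by have /eqP := v0 i; rewrite mulmxnE mulrn_eq0 => /eqP.
Qed.

Lemma angle_inj : injective angle.
Proof.
move=> v w e; apply/eqP; rewrite -subr_eq0; apply/eqP/(@angle_torsion _ 0).
by rewrite mulr1n angleD angleN e subrr.
Qed.

Lemma angle_delta i : angle (delta_mx 0 i) = alpha i.
Proof.
rewrite /angle (bigD1 i)//= mxE !eqxx mulr1z big1 ?addr0// => j ji.
by rewrite mxE (negbTE ji) andbF mulr0z.
Qed.

Lemma angle_closed (B : set (circle R)) :
  B 0 -> (forall x y, B x -> B y -> B (x - y)) -> (forall i, B (alpha i)) ->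
  forall v, B (angle v).
Proof.
move=> B0 BB Ba v.
have BN x : B x -> B (- x) by move=> Bx; rewrite -sub0r; exact: BB.
have BD x y : B x -> B y -> B (x + y) by move=> Bx /BN By; rewrite -(opprK y); exact: BB.
have BM x k : B x -> B (x *+ k).
  by move=> Bx; elim: k => [//|k IH]; rewrite mulrS; exact: BD.
apply: (big_ind B) => // i _; case: (v 0 i) => k; first by apply: BM; exact: Ba.
by apply/BN/BM/Ba.
Qed.

Let A := gen_zmod (range alpha).
Let Q := gen_group (range g).
Let H := gen_group (range (fun i => rotation (alpha i)) `|` range g).
Let V := conj_group q Q.

Lemma A_range_angle : A = range angle.
Proof.
apply/seteqP; split.
  apply: smallest_sub.
    split; first by exists 0 => //; exact: angle0.
    by move=> _ _ [v _ <-] [w _ <-]; exists (v - w); rewrite ?angleD ?angleN.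
  by move=> _ [i _ <-]; exists (delta_mx 0 i) => //; exact: angle_delta.
move=> _ [v _ <-]; apply: angle_closed.
- by move=> B [[B0 _] _].
- by move=> x y xA yA B CB; apply: CB.1.2; [exact: xA|exact: yA].
- by move=> i B CB; apply: CB.2; exists i.
Qed.

Lemma Q_sub_H : Q `<=` H.
Proof.
apply: gen_group_min; [exact: gen_group1|exact: gen_groupF|].
by move=> x Sx; apply: gen_group_sub; right.
Qed.

Lemma H_rotation v : H (rotation (angle v)).
Proof.
apply: (@angle_closed (fun a => H (rotation a))).
- by rewrite rotation0; exact: gen_group1.
- by move=> x y Hx Hy; rewrite rotationD rotationN; exact: gen_groupF.
- by move=> i; apply: gen_group_sub; left; exists i.
Qed.

Lemma H_drift h : H h -> exists v, drift h (angle v).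
Proof.
move: h; apply: gen_group_min.
- by exists 0; rewrite angle0; exact: drift1.
- move=> x y [v xv] [w yw]; exists (v - w); rewrite angleD angleN.
  by apply: driftM => //; exact: driftV.
- move=> _ [[i _ <-]|[j _ <-]].
    by exists (delta_mx 0 i); rewrite angle_delta; exact: drift_rotation.
  by have [t _ <-] := gQ j; exists 0; rewrite angle0; exact: drift_block.
Qed.

Lemma Q_block h : Q h -> exists2 t, t \in symbols q Q & h = block_iet R t.
Proof.
move=> Qh; suff [t e] : exists t : 'S_q, h = block_iet R t.
  by exists t => //; rewrite inE; apply/asboolP; rewrite -e.
move: h Qh; apply: gen_group_min.
- by exists 1%g; rewrite block_iet1.
- by move=> _ _ [t ->] [t' ->]; exists (t'^-1 * t)%g; rewrite block_ietV block_ietM.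
- by move=> _ [j _ <-]; have [t _ <-] := gQ j; exists t.
Qed.

Lemma symbolsP t : reflect (Q (block_iet R t)) (t \in symbols q Q).
Proof. by rewrite inE; exact: asboolP. Qed.

Lemma symbols_group_set : group_set (symbols q Q).
Proof.
apply/group_setP; split; first by apply/symbolsP; rewrite block_iet1; exact: gen_group1.
move=> t t' /symbolsP Qt /symbolsP Qt'; apply/symbolsP.
by rewrite -block_ietM; exact: gen_groupM.
Qed.

Definition symbol_group : {group 'S_q} := Group symbols_group_set.

(** A is dense: two multiples of one generator lie in the same cell, so their
    difference, taken in the right order, is a positive step shorter than a cell, and
    the multiples of this step cannot jump over a cell. *)
Lemma angle_cell (c : 'I_q) : (0 < s)%N -> exists v, cell_of n (angle v) = c.
Proof.
move=> s0; pose e : 'rV[int]_s := delta_mx 0 (Ordinal s0).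
have e_inj i j : e *+ i = e *+ j -> i = j.
  move=> /matrixP/(_ 0 (Ordinal s0)); rewrite !mulmxnE !mxE !eqxx /=.
  by rewrite !pmulrn !intz => -[].
suff [v [v0 v1]] : exists v, 0 < val (angle v) /\ val (angle v) < q%:R^-1.
  pose d := val (angle v); have q0 : 0 < q%:R :> R by rewrite ltr0n.
  pose x : R := c%:R / q%:R.
  have x0 : 0 <= x by rewrite divr_ge0.
  have x1 : x + q%:R^-1 <= 1.
    by rewrite -[X in _ + X]mul1r -mulrDl natr1 ler_pdivrMr// mul1r ler_nat.
  (* The first multiple of [d] beyond the left end [x] of the cell [c]. *)
  pose k := (Num.truncn (x / d)).+1.
  have /andP[k1 k2] : k.-1%:R <= x / d < k%:R by apply: truncn_itv; rewrite divr_ge0// ltW.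
  move: k1 k2; rewrite ler_pdivlMr// ltr_pdivrMr// => k1 k2.
  exists (v *+ k); rewrite angleMn -[angle v]mod1_val -mod1Mn -/d -mulr_natl.
  have k3 : k%:R * d = k.-1%:R * d + d by rewrite -natr1 mulrDl mul1r.
  have kd : 0 <= k%:R * d < 1.
    by apply/andP; split; move: v0 v1 x1; rewrite -/d; move: (q%:R^-1 : R) => qi; lra.
  apply/cell_ofP; rewrite mod1_id//.
  rewrite -[c.+1%:R]natr1 mulrDl mul1r -/x.
  by apply/andP; split; move: v0 v1 x1; rewrite -/d; move: (q%:R^-1 : R) => qi; lra.
have [i [j [ij cij]]] := pigeonhole_nat (fun i => cell_of n (angle (e *+ i))).
have nij : angle (e *+ i) <> angle (e *+ j) by move/angle_inj/e_inj.
have key w w' : cell_of n (angle w) = cell_of n (angle w') ->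
    val (angle w) < val (angle w') ->
    exists v, 0 < val (angle v) /\ val (angle v) < q%:R^-1.
  move=> cw lt; exists (w' - w).
  have /cell_ofP/andP[a1 _] := erefl (cell_of n (angle w)).
  have /cell_ofP/andP[_ b2] := esym cw.
  have /andP[a0 _] : 0 <= val (angle w) < 1 := circle_valP _.
  have /andP[_ b1] : 0 <= val (angle w') < 1 := circle_valP _.
  have -> : angle (w' - w) = mod1 (val (angle w') - val (angle w)).
    by rewrite angleD angleN mod1D mod1N !mod1_val.
  move: b2; rewrite -[(cell_of n (angle w)).+1%:R]natr1 mulrDl mul1r => b2.
  rewrite mod1_id; last by apply/andP; split; lra.
  split; first lra.
  move: a1 b2; move: (_^-1 : R) (_ / _ : R) => qi x; lra.
have [lt|lt|e'] := ltgtP (val (angle (e *+ i))) (val (angle (e *+ j))).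
- exact: key lt.
- exact: (key _ _ (esym cij) lt).
- by case: nij; apply: val_inj.
Qed.

(** A symbol [t] acts through the inverse of [t] because composition of
    permutations and of interval exchanges are in opposite orders. *)
Lemma lamplighter_embedding :
  abelian V -> 'C_(symbols q Q)[sigma]%g = 1%g ->
  exists f : wreath (subg_of symbol_group) (lattice s) -> IET R,
    [/\ is_hom f, injective f & range f = H].
Proof.
move=> Vab Ctriv.
pose io (l : subg_of symbol_group) := block_iet R (sgval l)^-1%g.
pose rho (v : lattice s) := rotation (angle v).
have ioM : is_hom io by move=> l l'; rewrite /io block_ietM -invMg.
have rhoM : is_hom rho by move=> v w; rewrite /rho -rotationD -angleD.
have sQ (l : subg_of symbol_group) : (sgval l)^-1%g \in symbols q Q.
  by have := subgP l; rewrite -groupV.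
have cC x y l l' :
    commute (rho x * io l * (rho x)^-1)%g (rho y * io l' * (rho y)^-1)%g.
  exact: (conj_block_commute _ _ Vab (sQ l) (sQ l')).
have cfree (r : seq (lattice s)) (f : lattice s -> subg_of symbol_group)
    (a : lattice s) :
    uniq r -> (\prod_(x <- r) (rho x * io (f x) * (rho x)^-1) = rho a)%g ->
    a = 1%g /\ forall x, x \in r -> f x = 1%g.
  move=> ru e.
  have a1 : a = 1%g.
    apply: (@angle_torsion a n).
    rewrite -[angle a]subr0; apply: (drift_uniq (h := rho a)).
      exact: drift_rotation.
    rewrite -e; apply: (big_ind (drift ^~ 0)); first exact: drift1.
      by move=> x y dx dy; rewrite -(addr0 0); exact: driftM.
    by move=> v _; exact: (drift_conj_block (n := n) (angle v) (sgval (f v))^-1%g).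
  split=> // x xr.
  have := @conj_block_free R n _ r angle (fun x => (sgval (f x))^-1%g) ru.
  rewrite -[X in _ -> X = _ -> _]/(\prod_(x <- r) (rho x * io (f x) * (rho x)^-1))%g e.
  rewrite a1 /rho angle0 rotation0 => /(_ _ erefl x xr) fC.
  have : (sgval (f x))^-1%g \in 'C_(symbols q Q)[sigma]%g.
    rewrite inE sQ; apply/cent1P/fC => v w _ _.
    by rewrite -angleN -angleD => /angle_torsion/eqP; rewrite subr_eq0 => /eqP.
  rewrite Ctriv => /set1P/(congr1 (fun t => t^-1)%g).
  by rewrite invgK invg1 => f1; apply: val_inj.
have [f [fM fI fH]] := wreath_recognition ioM rhoM cC cfree.
exists f; split=> //; rewrite fH; apply/seteqP; split.
  apply: gen_group_min; [exact: gen_group1|exact: gen_groupF|].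
  move=> _ [[v _ <-]|[l _ <-]]; first exact: H_rotation.
  by apply: Q_sub_H; apply/symbolsP; exact: sQ.
apply: gen_group_min; [exact: gen_group1|exact: gen_groupF|].
move=> _ [[i _ <-]|[j _ <-]]; apply: gen_group_sub.
  by left; exists (delta_mx 0 i) => //; congr rotation; exact: angle_delta.
right; have Qg : Q (g j) by apply: gen_group_sub; exists j.
have [t tQ ->] := Q_block Qg.
have tG : t \in symbol_group by [].
by exists (subg symbol_group t^-1%g) => //; rewrite /io subgK ?groupV// invgK.
Qed.

(** * Consequences of a wreath product structure *)

Section Embedded.
Variables (L G : groupType) (f : wreath L G -> IET R).
Hypotheses (fM : is_hom f) (fI : injective f) (fH : range f = H).
Hypothesis G_torsion_free : forall (x : G) k, (x ^+ k.+1 = 1)%g -> x = 1%g.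
Variable xs : nat -> G.
Hypothesis xs_inj : injective xs.

Lemma embedding_drift w : exists v, drift (f w) (angle v).
Proof. by apply: H_drift; rewrite -fH; exists w. Qed.

Lemma drift0_torsion w : drift (f w) 0 -> exists k, (w ^+ k.+1 = 1)%g.
Proof.
move=> /drift_torsion e; exists #|[set: 'S_q]%SET|.-1.
rewrite prednK ?cardG_gt0//; apply: fI.
by rewrite homX// e hom1.
Qed.

Lemma comm_drift h k : H h -> H k -> drift (h * k * (k * h)^-1)%g 0.
Proof.
move=> /H_drift[v hv] /H_drift[w kw]; rewrite -(subrr (angle v + angle w)).
apply: driftM; first exact: driftM.
by apply: driftV; rewrite addrC; exact: driftM.
Qed.

(** The quotient of two copies of [l] is a commutator, of drift 0, hence of finite
    order. *)
Lemma lamp_torsion (l : L) : exists k, (l ^+ k.+1 = 1)%g.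
Proof.
(* [z] moves the index [x] to [y]. *)
pose x := xs 0; pose y := xs 1; pose z := (y * x^-1)%g.
have xy : x <> y by move/xs_inj.
have Hf w : H (f w) by rewrite -fH; exists w.
have := comm_drift (Hf (lamp x l)) (Hf (shift z)).
rewrite -!fM -homV// -fM => /drift0_torsion[k e]; exists k.
have wE : (lamp x l * shift z * (shift z * lamp x l)^-1 =
    lamp x l * lamp y l^-1)%g.
  rewrite -[y in RHS](mulgVK x) -/z -shift_lamp invgM.
  by rewrite (homV _ (lampM x)) !mulgA.
have := congr1 (fun w => wr_base w x) e; rewrite wE base_expg /= ?mulg1//.
by rewrite invg1 mul1g eqxx; case: eqP => // _; rewrite mulg1.
Qed.

(** An element of drift 0 has finite order, and [G] is torsion free.  Conversely
    lamps have finite order and A is torsion free, so lamps have drift 0. *)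
Lemma base_drift w : wr_top w = 1%g <-> drift (f w) 0.
Proof.
split=> [|/drift0_torsion[k e]]; last first.
  apply: (G_torsion_free (k := k)).
  by rewrite -(homX _ _ (@wr_topM L G)) e.
move: w; apply: base_ind.
- by rewrite hom1//; exact: drift1.
- move=> x l; have [v dv] := embedding_drift (lamp x l).
  have [k lk] := lamp_torsion l.
  have : drift (f (lamp x l ^+ k.+1)%g) (angle (v *+ k.+1)).
    move: k.+1 => j; elim: j => [|j IH].
      by rewrite mulr0n angle0 expg0 hom1//; exact: drift1.
    by rewrite expgS fM mulrS angleD; exact: driftM.
  rewrite -(homX _ _ (lampM x)) lk !hom1//; last exact: lampM.
  move=> /(drift_uniq (drift1 (R := R) n)); rewrite sub0r -angleN => /angle_torsion v0.
  have {}v0 : v = 0.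
    apply: (angle_torsion (k := k)).
    by rewrite -angleMn -[v *+ _]opprK v0 oppr0 angle0.
  by move: dv; rewrite v0 angle0.
- by move=> u v _ _ du dv; rewrite fM -(addr0 0); exact: driftM.
Qed.

Lemma top_drift w v : drift (f w) (angle v) -> wr_top w = 1%g -> v = 0.
Proof.
move=> dv /base_drift d0; have := drift_uniq dv d0.
by rewrite subr0 => /angle_torsion.
Qed.

(** If [l] and [l'] do not commute, neither do their copies [h 1] and [h' 1], on
    a right neighbourhood of some point [p0].  The copies with index [x] then do not
    commute on a translate of this neighbourhood.  Among infinitely many indices two,
    [x] and [x'], have translates that contain a common fibre, on which moreover
    [h x] and [h x'] induce the same permutation.  But [h x'] commutes with
    [h' x], and [h x] does not. *)
Lemma lamps_commute (l l' : L) : commute l l'.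
Proof.
apply: contrapT => ll'.
pose h x := f (lamp x l); pose h' x := f (lamp x l').
have hd x : drift (h x) 0 by apply/base_drift.
have hd' x : drift (h' x) 0 by apply/base_drift.
have hc x y : x <> y -> commute (h x) (h' y).
  move=> xy; rewrite /commute -!fM; congr f.
  apply: wreath_eq => [z|] //=; rewrite !invg1 !mul1g.
  by case: eqP => [->|]; case: eqP; rewrite ?mulg1 ?mul1g.
have [p0 p0P] : exists p, (h 1%g * h' 1%g)%g p <> (h' 1%g * h 1%g)%g p.
  apply: contrapT => /forallNP nc; apply: ll'.
  have /fI : f (lamp 1%g l * lamp 1%g l')%g = f (lamp 1%g l' * lamp 1%g l)%g.
    by rewrite !fM; apply: iet_eq => p; have /contrapT := nc p.
  by move=> /(congr1 (fun w => wr_base w 1%g)) /=; rewrite invg1 mul1g eqxx.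
have [e1 e10 e1P] := iet_right_translation (h 1%g * h' 1%g)%g p0.
have [e2 e20 e2P] := iet_right_translation (h' 1%g * h 1%g)%g p0.
pose e := Num.min e1 e2; have e0 : 0 < e by rewrite lt_min e10.
have [K Ke] : exists K, K.+1%:R^-1 < e.
  exists (Num.truncn e^-1); rewrite invf_plt ?posrE// ?ltr0n//.
  have ei : 0 < e^-1 by rewrite invr_gt0.
  by have /andP[] := truncn_itv (ltW ei).
have noncomm t : 0 <= t < e ->
    (h 1%g * h' 1%g)%g (p0 + mod1 t) <> (h' 1%g * h 1%g)%g (p0 + mod1 t).
  rewrite lt_min => /and3P[t0 t1 t2].
  by rewrite e1P ?t0// e2P ?t0//; move/addIr.
have /choice[b bP] i : exists b, drift (f (shift (xs i))) b.
  by have [v] := embedding_drift (shift (xs i)); exists (angle v).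
pose j i : 'I_K.+1 := cell_of K (- b i).
(* If the inverse of the drift [b] of the [i]-th shift is in the [j]-th cell of
   length 1/(K+1) < e, then the fibre of [P j - b] meets the neighbourhood of
   [p0] of length [e]. *)
pose P (j : 'I_K.+1) := p0 - mod1 (j%:R / K.+1%:R).
have /choice[S SP] i : exists S : 'S_q, fibre_perm (h (xs i)) (P (j i)) S.
  exact: (drift_fibre_perm _ (hd _)).
have [i [i' [ii' [jE SE]]]] := pigeonhole_nat (fun i => (j i, S i)).
have [S' S'P] := drift_fibre_perm (P (j i)) (hd' (xs i)).
have SS' : commute (S i) S'.
  have c := hc (xs i') (xs i) (fun e => ii' (esym (xs_inj e))).
  have := SP i'; rewrite -jE -SE => Si'.
  have := fibre_permM S'P Si'; rewrite -c => c1.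
  exact: fibre_perm_uniq c1 (fibre_permM Si' S'P).
pose t := val (- b i) - (j i)%:R / K.+1%:R.
have /cell_ofP/andP[t1 t2] := erefl (j i).
have te : 0 <= t < e.
  rewrite subr_ge0 t1; apply: lt_trans Ke; rewrite ltrBlDl.
  by apply: lt_le_trans t2 _; rewrite -natr1 mulrDl mul1r.
apply: (noncomm t te).
have yE : p0 + mod1 t = P (j i) - b i.
  by rewrite /P /t mod1D mod1N mod1_val addrCA addrC.
have [k kE] := torsion_step (bP i (p0 + mod1 t)).
set y := p0 + mod1 t in yE kE *; set r := f (shift (xs i)) in kE.
have ry : r y = P (j i) + u *+ k.
  have -> : P (j i) = y + b i by rewrite yE subrK.
  by rewrite -kE -[r y - y - _]addrA -opprD [RHS]addrC subrK.
have hx : h (xs i) = (r * h 1%g * r^-1)%g.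
  by rewrite /h /r -homV// -!fM shift_lamp mulg1.
have hx' : h' (xs i) = (r * h' 1%g * r^-1)%g.
  by rewrite /h' /r -homV// -!fM shift_lamp mulg1.
have e3 : (r * (h 1%g * h' 1%g))%g y = (r * (h' 1%g * h 1%g))%g y.
  have -> : (r * (h 1%g * h' 1%g) = h (xs i) * h' (xs i) * r)%g.
    by rewrite hx hx' !mulgA !mulgVK.
  have -> : (r * (h' 1%g * h 1%g) = h' (xs i) * h (xs i) * r)%g.
    by rewrite hx hx' !mulgA !mulgVK.
  have rE (h1 : IET R) : (h1 * r)%g y = h1 (P (j i) + u *+ k) by rewrite -ry.
  by rewrite !rE (fibre_permM (SP i) S'P) (fibre_permM S'P (SP i)) SS'.
exact: (@iet_inj _ r).
Qed.

Lemma drift0_commute h k : H h -> H k -> drift h 0 -> drift k 0 -> commute h k.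
Proof.
rewrite -fH => -[v _ <-] [w _ <-] /base_drift v1 /base_drift w1.
rewrite /commute -!fM; congr f; apply: base_commute => //; exact: lamps_commute.
Qed.

(** On the fibre of 0 the elements [conj_block a t] induce all conjugates of [t]
    by powers of sigma, as A is dense. *)
Lemma abelian_V : (0 < s)%N -> abelian V.
Proof.
move=> s0; rewrite /V /conj_group abelian_gen; apply/centsP.
have key (x : 'S_q) :
    x \in (\bigcup_(p < q) (symbols q Q :^ (sigma ^+ p))%g)%SET ->
    exists h, [/\ H h, drift h 0 & fibre_perm h 0 x].
  case/bigcupP => p _ /imsetP[t tQ ->].
  (* A point in the cell q - p makes sigma ^+ p the conjugator; the remainder
     covers p = 0. *)
  have cq : ((q - p) %% q < q)%N by rewrite ltn_mod.
  have [v vc] := angle_cell (Ordinal cq) s0.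
  exists (conj_block (angle (- v)) t); split; last 2 first.
  - exact: drift_conj_block.
  - rewrite (_ : t ^ _ = fibre_symbol (0 - angle (- v)) t)%g.
      exact: fibre_perm_conj_block.
    rewrite /fibre_symbol sub0r -angleN opprK vc; congr (_ ^ _)%g => /=.
    rewrite (expg_mod _ (sigmaX_order R n)).
    apply: (mulIg (sigma ^+ (q - p))%g); rewrite mulVg -expgD subnKC ?sigmaX_order//.
    exact/ltnW/ltn_ord.
  - apply: gen_groupF; last exact: H_rotation.
    apply: gen_groupM.
      exact: H_rotation.
    by apply: Q_sub_H; apply/symbolsP.
move=> x /key[h [Hh dh hx]] y /key[k [Hk dk ky]].
have c := drift0_commute Hk Hh dk dh.
apply: (fibre_perm_uniq (h := (k * h)%g)); first exact: fibre_permM.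
by rewrite c; exact: fibre_permM.
Qed.

(** A block permutation whose symbol commutes with sigma commutes with all
    rotations, and with the abelian group of elements of drift 0: it is central. *)
Lemma centralizer_trivial : 'C_(symbols q Q)[sigma]%g = 1%g.
Proof.
apply/eqP; rewrite finset.eqEsubset finset.sub1set; apply/andP; split; last first.
  by apply/setIP; split; [exact: (group1 symbol_group)|exact: group1].
apply/fintype.subsetP => t /setIP[tQ /cent1P tC].
have HE : H (block_iet R t) by apply: Q_sub_H; apply/symbolsP.
have sp a : conj_block a t = block_iet R t.
  have st (p : circle R) : fibre_symbol p t = t.
    by rewrite /fibre_symbol conjgE (commuteV (commuteX _ tC)) mulKg.
  apply: eq_fibre_perm => p; exists t; split.
    by rewrite -[X in fibre_perm _ _ X](st (p - a)); exact: fibre_perm_conj_block.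
  by rewrite -[X in fibre_perm _ _ X](st p); exact: fibre_perm_block.
have EC h : H h -> commute h (block_iet R t).
  suff : H `<=` [set h | H h /\ commute h (block_iet R t)] by move=> /[apply] -[].
  apply: gen_group_min; first by split; [exact: gen_group1|exact/commute_sym/commute1].
    move=> x y [Hx xC] [Hy yC]; split; first exact: gen_groupF.
    by apply/commute_sym/commuteM; [exact: commute_sym|exact/commuteV/commute_sym].
  move=> _ [[i _ <-]|[j _ <-]].
    split; first by apply: gen_group_sub; left; exists i.
    apply: (mulIg (rotation (alpha i))^-1%g).
    by rewrite mulgK; exact: sp.
  split; first by apply: gen_group_sub; right; exists j.
  apply: drift0_commute => //; last exact: drift_block.
    by apply: gen_group_sub; right; exists j.
  by have [t' _ <-] := gQ j; exact: drift_block.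
have [w _ wE] : range f (block_iet R t) by rewrite fH.
have w1 : w = 1%g.
  apply: (wreath_center xs_inj).
    by apply/base_drift; rewrite wE; exact: drift_block.
  move=> v; apply: fI; rewrite !fM wE; apply: EC.
  by rewrite -fH; exists v.
rewrite inE; apply/eqP/(@block_iet_inj R n).
by rewrite block_iet1 -wE w1 hom1.
Qed.

(** If Q is trivial, H consists of rotations, and only the identity has drift 0. *)
Lemma Q_nontrivial : nontrivial L -> Q <> [set 1%g].
Proof.
move=> [l l1] Q1; apply: l1.
have Hrot : H `<=` range (fun v => rotation (angle v)).
  apply: gen_group_min.
  - by exists 0 => //; rewrite angle0 rotation0.
  - move=> _ _ [v _ <-] [w _ <-]; exists (v - w) => //.
    by rewrite angleD angleN rotationD rotationN.
  - move=> _ [[i _ <-]|[j _ <-]].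
      exists (delta_mx 0 i) => //; congr rotation; exact: angle_delta.
    have : Q (g j) by apply: gen_group_sub; exists j.
    by rewrite Q1 => ->; exists 0 => //; rewrite angle0 rotation0.
have [v _ vE] : range (fun v => rotation (angle v)) (f (lamp 1%g l)).
  by apply: Hrot; rewrite -fH; exists (lamp 1%g l).
have v0 : v = 0.
  apply: (top_drift (w := lamp 1%g l)) => //.
  by rewrite -vE; exact: drift_rotation.
have /fI : f (lamp 1%g l) = f 1%g by rewrite -vE v0 angle0 rotation0 hom1.
by move=> /(congr1 (fun w => wr_base w 1%g)) /=; rewrite eqxx.
Qed.

(** A rotation by an element of A is determined by its drift, hence by its
    top component. *)
Lemma A_iso (k : nat) (theta : G -> 'rV[int]_k) :
  set_bij [set: G] [set: 'rV[int]_k] theta ->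
  {morph theta : x y / (x * y)%g >-> x + y} ->
  group_iso (fun x y : circle R => x + y) (fun x y : 'rV[int]_k => x + y)
    A [set: 'rV[int]_k].
Proof.
move=> [_ thI thS] thM.
have /choice[phi phiP] a : exists w, A a -> f w = rotation a.
  have [|nA] := pselect (A a); last by exists 1%g.
  rewrite A_range_angle => -[v _ <-].
  have [w _ wE] : range f (rotation (angle v)) by rewrite fH; exact: H_rotation.
  by exists w.
have ADD a b : A a -> A b -> A (a + b).
  rewrite A_range_angle => -[v _ <-] [w _ <-]; exists (v + w) => //; exact: angleD.
have phiM a b : A a -> A b -> phi (a + b) = (phi a * phi b)%g.
  by move=> Aa Ab; apply: fI; rewrite fM !phiP ?rotationD//; exact: ADD.
exists (fun a => theta (wr_top (phi a))); last first.
  by move=> a b Aa Ab; rewrite phiM// wr_topM thM.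
split=> //.
- move=> a b; rewrite !inE => Aa Ab /thI; rewrite !inE => /(_ I I) e.
  have : drift (f (phi a * (phi b)^-1)%g) (a - b).
    rewrite fM homV// !phiP//; apply: driftM; first exact: drift_rotation.
    by apply: driftV; exact: drift_rotation.
  move: Aa Ab e; rewrite A_range_angle => -[v _ <-] [w _ <-] e.
  rewrite -angleN -angleD => /top_drift vw; have : v - w = 0.
    by apply: vw; rewrite wr_topM /= e mulgV.
  by move/eqP; rewrite subr_eq0 => /eqP->.
- move=> y _; have [x _ <-] := thS y I.
  have [v dv] := embedding_drift (shift x); exists (angle v).
    by rewrite A_range_angle; exists v.
  congr theta; apply/eqP; rewrite -divg_eq1; apply/eqP.
  have Av : A (angle v) by rewrite A_range_angle; exists v.
  rewrite -[x]/(wr_top (shift x : wreath L G)) -[(_^-1)%g]/(wr_top (shift x)^-1)%g.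
  rewrite -wr_topM; apply/base_drift; rewrite fM homV// phiP// -(subrr (angle v)).
  by apply: driftM; [exact: drift_rotation|exact: driftV].
Qed.

End Embedded.

(** Both descriptions of H have the elements of drift 0 as base. *)
Lemma Q_iso (L1 G1 L2 G2 : groupType) (f1 : wreath L1 G1 -> IET R)
    (f2 : wreath L2 G2 -> IET R) :
  is_hom f1 -> injective f1 -> range f1 = H ->
  is_hom f2 -> injective f2 -> range f2 = H ->
  (forall w, wr_top w = 1%g <-> drift (f1 w) 0) ->
  (forall w, wr_top w = 1%g <-> drift (f2 w) 0) ->
  (forall l l' : L1, commute l l') -> (forall l l' : L2, commute l l') ->
  exists h : L1 -> L2, is_hom h /\ bijective h.
Proof.
move=> f1M f1I f1H f2M f2I f2H b1 b2 c1 c2.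
have /choice[a aP] w : exists v, f2 v = f1 w.
  by have [v _ vE] : range f2 (f1 w); [rewrite f2H -f1H; exists w|exists v].
have /choice[b bP] w : exists v, f1 v = f2 w.
  by have [v _ vE] : range f1 (f2 w); [rewrite f1H -f2H; exists w|exists v].
apply: (@wreath_lamp_iso _ _ _ _ a b) => //.
- by move=> v w; apply: f2I; rewrite f2M !aP f1M.
- by move=> v w; apply: f1I; rewrite f1M !bP f2M.
- by move=> w; apply: f1I; rewrite bP aP.
- by move=> w; apply: f2I; rewrite aP bP.
- by move=> w; rewrite b1 b2 aP.
Qed.

End Main.

(** * The equivalence *)

Theorem corollary3 (R : realType) (s m q : nat)
    (alpha : 'I_s -> circle R) (g : 'I_m -> IET R) :
  (0 < s)%N -> (0 < m)%N -> (0 < q)%N ->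
  (forall i, irrational (val (alpha i))) ->
  Q_independent alpha ->
  (forall j, block_group q (g j)) ->
  let A := gen_zmod (range alpha) in
  let Q := gen_group (range g) in
  let H := gen_group (range (fun i => rotation (alpha i)) `|` range g) in
  let V := conj_group q Q in
  ((exists k (L G : groupType), lamplighter_iso H k L G) <->
     [/\ abelian V, Q <> [set 1%g]
       & 'C_(symbols q Q)[cycle_perm q]%g = 1%g]) /\
  (forall k (L G : groupType), lamplighter_iso H k L G ->
     [/\ group_iso (fun x y : circle R => x + y)
           (fun x y : 'rV[int]_k => x + y) A [set: 'rV[int]_k],
         group_iso (fun x y : IET R => (x * y)%g) (fun x y : L => (x * y)%g)
           Q [set: L],
         finite_set Q &
         forall x y, Q x -> Q y -> (x * y = y * x)%g]).
Proof.
case: q => // n s0 _ _ _ alphaI gQ A Q H V.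
have emb k (L G : groupType) : lamplighter_iso H k L G ->
    exists f : wreath L G -> IET R, [/\ is_hom f, injective f & range f = H].
  case=> _ _ _ _; apply: embedding_of_group_iso; first exact: gen_group1.
  exact: gen_groupM.
have lat_id k : set_bij [set: lattice k] [set: 'rV[int]_k] id.
  by split.
have only_if k (L G : groupType) : lamplighter_iso H k L G ->
    [/\ abelian V, Q <> [set 1%g] & 'C_(symbols n.+1 Q)[cycle_perm n.+1]%g = 1%g].
  move=> HW; have [f [fM fI fH]] := emb _ _ _ HW.
  have [k0 Lnt _ [theta thB thM] _] := HW.
  have [Gtf [xs xsI]] := lattice_torsion_free_infinite k0 thB (fun x y => thM x y I I).
  split.
  - exact: (abelian_V alphaI gQ fM fI fH Gtf xsI).
  - exact: (Q_nontrivial alphaI gQ fM fI fH Gtf xsI).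
  - exact: (centralizer_trivial alphaI gQ fM fI fH Gtf xsI).
have [latf [latx latxI]] := lattice_torsion_free_infinite s0 (lat_id s) (fun x y => erefl).
split.
  split=> [[k [L [G]]]|[Vab Q1 Ctriv]]; first exact: only_if.
  exists s, (subg_of (symbol_group n g)), (lattice s).
  have [f [fM fI fH]] := lamplighter_embedding alphaI gQ Vab Ctriv.
  split=> //.
  - have [t [tQ t1]] : exists t, t \in symbol_group n g /\ t <> 1%g.
      apply: contrapT => /forallNP nt; apply: Q1; apply/seteqP; split.
        move=> E /(Q_block gQ)[t tQ ->] /=.
        have [->|t1] := eqVneq t 1%g; first exact: block_iet1.
        by case: (nt t); split=> //; apply/eqP.
      by move=> _ ->; exact: gen_group1.
    exists (subg (symbol_group n g) t) => /(congr1 (@sgval _ _)).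
    by rewrite subgK.
  - exists setT; first exact: finite_finset.
    apply/seteqP; split=> // x _; exact: gen_group_sub.
  - by exists id; [exact: lat_id|].
  - exact: group_iso_of_embedding fM fI fH.
move=> k L G HW; have [f [fM fI fH]] := emb _ _ _ HW.
have [k0 Lnt _ [theta thB thM] _] := HW.
have thM' : {morph theta : x y / (x * y)%g >-> x + y} by move=> x y; exact: thM.
have [Gtf [xs xsI]] := lattice_torsion_free_infinite k0 thB thM'.
have [Vab Q1 Ctriv] := only_if _ _ _ HW.
split.
- exact: (A_iso alphaI gQ fM fI fH Gtf xsI thB thM').
- have [f' [f'M f'I f'H]] := lamplighter_embedding alphaI gQ Vab Ctriv.
  have [h [hM hB]] := Q_iso f'M f'I f'H fM fI fH
    (base_drift alphaI gQ f'M f'I f'H latf latxI)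
    (base_drift alphaI gQ fM fI fH Gtf xsI)
    (lamps_commute alphaI gQ f'M f'I f'H latf latxI)
    (lamps_commute alphaI gQ fM fI fH Gtf xsI).
  have /choice[t tP] (E : IET R) : exists t, Q E ->
      t \in symbol_group n g /\ E = block_iet R t.
    have [QE|nQ] := pselect (Q E); last by exists 1%g.
    by have [t tQ ->] := Q_block gQ QE; exists t.
  have tM E E' : Q E -> Q E' -> t (E * E')%g = (t E' * t E)%g.
    move=> QE QE'; apply: (@block_iet_inj R n).
    rewrite -block_ietM -(tP _ QE).2 -(tP _ QE').2.
    by rewrite -(tP _ (gen_groupM QE QE')).2.
  (* The inverse turns the anti-isomorphism between Q and its symbols into an
     isomorphism. *)
  exists (fun E => h (subg (symbol_group n g) (t E)^-1%g)); last first.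
    move=> E E' QE QE'; rewrite -hM tM// invgM; congr h.
    by apply: val_inj; rewrite /= !subgK ?groupM ?groupV ?(tP _ QE).1 ?(tP _ QE').1.
  split=> //.
  - move=> E E'; rewrite !inE => QE QE' /(bij_inj hB)/(congr1 (@sgval _ _)).
    rewrite !subgK ?groupV ?(tP _ QE).1 ?(tP _ QE').1// => /invg_inj e.
    by rewrite (tP _ QE).2 e -(tP _ QE').2.
  - move=> l _; have [h' _ h'K] := hB.
    pose E := block_iet R (sgval (h' l))^-1%g.
    have QE : Q E by apply/symbolsP; have := subgP (h' l); rewrite -groupV.
    exists E => //; rewrite -[RHS]h'K; congr h; apply: val_inj => /=.
    have /(@block_iet_inj R n) e := (tP _ QE).2.
    by rewrite -e invgK subgK// subgP.
- apply: (@sub_finite_set _ _ (range (@block_iet R n.+1))).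
    by move=> E /(Q_block gQ)[t _ ->]; exists t.
  exact/finite_image/finite_finset.
- move=> x y Qx Qy.
  apply: (drift0_commute alphaI gQ fM fI fH Gtf xsI); try exact: Q_sub_H.
    by have [t _ ->] := Q_block gQ Qx; exact: drift_block.
  by have [t _ ->] := Q_block gQ Qy; exact: drift_block.
Qed.
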